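(* Suppose that $p \in S_{G}^{\mathrm{inv}}(\mathcal{U},M)$ is a strong right $f$-generic type over $M$. Then (1) $p * S_{G}^{\mathrm{inv}}(\mathcal{U},M)$ is an Ellis subgroup of $S_{G}^{\mathrm{inv}}(\mathcal{U},M)$; (2) $p * S_{G}^{\mathrm{inv}}(\mathcal{U},M) = p \cdot G(\mathcal{U}) = p * S_G(\mathcal{U})$; (3) if $B \subseteq G(\mathcal{U})$ is a set of (unique) representatives of the $G^{00}(\mathcal{U})$-cosets in $G(\mathcal{U})$, then $p \cdot G(\mathcal{U}) = p \cdot B$; (4) the map $\hat{\pi} : p \cdot B \to G(\mathcal{U})/G^{00}(\mathcal{U})$ is a group isomorphism. As a consequence, the map $\hat{\pi}|_{p * S_{G}^{\mathrm{inv}}(\mathcal{U},M)}$ is a group isomorphism onto $G(\mathcal{U})/G^{00}(\mathcal{U})$.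
   Context: Let $T$ be an NIP first-order theory, $\mathcal{U}$ a monster model of $T$, and $M$ a small elementary submodel of $\mathcal{U}$. Let $G(x)$ be an $\emptyset$-definable group which is definably amenable. $S_G(\mathcal{U})$ denotes the space of global types concentrating on $G$, and $S_{G}^{\mathrm{inv}}(\mathcal{U},M)$ the subspace of those that are $M$-invariant. For $p \in S_{G}^{\mathrm{inv}}(\mathcal{U},M)$ and $q \in S_G(\mathcal{U})$, the Newelski product $p*q$ is defined by: $\varphi(x,d) \in p*q$ iff $\varphi(x\cdot b,d) \in p$ where $b \models q|_{Md}$; with this product $S_{G}^{\mathrm{inv}}(\mathcal{U},M)$ is a left-continuous compact Hausdorff semigroup. For $c \in G(\mathcal{U})$, the right translate $p\cdot c$ is given by $\varphi(x) \in p\cdot c$ iff $\varphi(x\cdot c)\in p$. A type $p \in S_{G}^{\mathrm{inv}}(\mathcal{U},M)$ is strong right $f$-generic over $M$ if every global right translate of $p$ is $M$-invariant. $G^{00}(\mathcal{U})$ is the smallest type-definable subgroup of bounded index (by NIP it does not depend on the parameter set, so it is $\emptyset$-type-definable); $\pi: G(\mathcal{U}) \to G(\mathcal{U})/G^{00}(\mathcal{U})$ is the quotient map and $\hat{\pi}: S_G(\mathcal{U}) \to G(\mathcal{U})/G^{00}(\mathcal{U})$ its canonical extension to types (sending a type to the coset of any of its realizations), whose restriction to $S_{G}^{\mathrm{inv}}(\mathcal{U},M)$ is a continuous semigroup homomorphism. An Ellis subgroup is a group of the form $u * I$ where $I$ is a minimal left ideal of the semigroup and $u \in I$ an idempotent.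 *)

(* Defs.v *)
From mathcomp Require Import all_boot all_order all_algebra.
From mathcomp Require Import all_classical all_reals.

Set Implicit Arguments.
Unset Strict Implicit.
Unset Printing Implicit Defensive.

Import Order.TTheory GRing.Theory Num.Theory.
Local Open Scope classical_set_scope.

(** * First-order logic *)

Record language := Language {
  fsym : Type;
  farity : fsym -> nat;
  rsym : Type;
  rarity : rsym -> nat }.

Section Syntax.
Variable L : language.

Inductive term (V : Type) : Type :=
| Var of V
| App (f : fsym L) of ('I_(farity f) -> term V).

(* Formulas with free variables in [V]; [None] is the variable bound by
   [FAll]. *)
Inductive formula (V : Type) : Type :=
| FBot
| FEq of term V & term V
| FRel (r : rsym L) of ('I_(rarity r) -> term V)
| FImp of formula V & formula V
| FAll of formula (option V).

Definition theory := set (formula void).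

Record structure := Structure {
  carrier :> Type;
  carrier_inhabited : inhabited carrier;
  fint : forall f : fsym L, ('I_(farity f) -> carrier) -> carrier;
  rint : forall r : rsym L, ('I_(rarity r) -> carrier) -> Prop }.

End Syntax.

Arguments Var {L V}.
Arguments App {L V}.
Arguments FBot {L V}.
Arguments FEq {L V}.
Arguments FRel {L V}.
Arguments FImp {L V}.
Arguments FAll {L V}.
Arguments fint {L} s f.
Arguments rint {L} s r.

Section Semantics.
Variable L : language.

Fixpoint eval (U : structure L) (V : Type) (v : V -> U) (t : term L V) : U :=
  match t with
  | Var x => v x
  | App f args => fint U f (fun i => eval v (args i))
  end.

Definition extend (X V : Type) (v : V -> X) (a : X) : option V -> X :=
  fun o => if o is Some x then v x else a.

Fixpoint sat (U : structure L) (V : Type) (v : V -> U) (phi : formula L V)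
    {struct phi} : Prop :=
  match phi with
  | FBot => False
  | FEq s t => eval v s = eval v t
  | FRel r args => rint U r (fun i => eval v (args i))
  | FImp psi chi => sat v psi -> sat v chi
  | FAll psi => forall a : U, sat (extend v a) psi
  end.

Definition models (U : structure L) (T : theory L) :=
  forall phi, T phi -> sat (of_void U) phi.

Definition concat (X V W : Type) (x : V -> X) (y : W -> X) : V + W -> X :=
  fun s => match s with inl i => x i | inr j => y j end.

(* No partitioned formula phi(x;y) shatters an infinite set of tuples in a
   model of T. *)
Definition NIP (T : theory L) :=
  forall (n m : nat) (phi : formula L ('I_n + 'I_m)) (N : structure L),
    models N T ->
    ~ exists (a : nat -> 'I_n -> N) (b : set nat -> 'I_m -> N),
        forall i s, sat (concat (a i) (b s)) phi <-> s i.

Definition elementary_embedding (N U : structure L) (e : N -> U) :=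
  forall (m : nat) (phi : formula L 'I_m) (v : 'I_m -> N),
    sat v phi <-> sat (e \o v) phi.

Definition elementary_submodel (U : structure L) (M : set U) :=
  exists (N : structure L) (e : N -> U), elementary_embedding e /\ range e = M.

Definition automorphism (U : structure L) (sigma : U -> U) :=
  [/\ bijective sigma,
      forall (f : fsym L) args, sigma (fint U f args) = fint U f (sigma \o args)
    & forall (r : rsym L) args, rint U r args <-> rint U r (sigma \o args)].

Definition automorphism_over (U : structure L) (A : set U) (sigma : U -> U) :=
  automorphism sigma /\ forall a, A a -> sigma a = a.

(** * Definable sets and types *)

Definition definable (U : structure L) (V : Type) (A : set U)
    (D : set (V -> U)) :=
  exists (m : nat) (phi : formula L (V + 'I_m)) (c : 'I_m -> U),
    (forall i, A (c i)) /\ D = [set x | sat (concat x c) phi].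

(* Complete types over A, as ultrafilters of the Boolean algebra of A-definable
   sets, i.e., of formulas over A up to equivalence in U. *)
Definition complete_type (U : structure L) (V : Type) (A : set U)
    (p : set (set (V -> U))) :=
  [/\ p `<=` definable A,
      ~ p set0,
      forall D E, p D -> p E -> p (D `&` E),
      forall D E, p D -> definable A E -> D `<=` E -> p E
    & forall D, definable A D -> p D \/ p (~` D)].

(* b realizes the restriction of p to A. *)
Definition realizes (U : structure L) (V : Type) (A : set U)
    (p : set (set (V -> U))) (b : V -> U) :=
  forall D, p D -> definable A D -> D b.

Definition invariant (U : structure L) (V : Type) (A : set U)
    (p : set (set (V -> U))) :=
  forall sigma, automorphism_over A sigma ->
  forall D, p D <-> p [set sigma \o x | x in D].

(** * Monster models *)

(* |A| < |K|.  The cardinal kappa = |K| bounds what is called small. *)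
Definition small (K X : Type) (A : set X) : Prop := ~ ([set: K] #<= A)%card.

Definition saturated (K : Type) (U : structure L) :=
  forall (n : nat) (A : set U) (p : set (set ('I_n -> U))),
    small K A -> complete_type A p -> exists b, realizes A p b.

Definition strongly_homogeneous (K : Type) (U : structure L) :=
  forall (A : set U) (f : U -> U), small K A ->
    (forall (m : nat) (phi : formula L 'I_m) (a : 'I_m -> U),
       (forall i, A (a i)) -> (sat a phi <-> sat (f \o a) phi)) ->
    exists sigma, automorphism sigma /\ forall a, A a -> sigma a = f a.

(* kappa is an uncountable strong limit cardinal greater than |L|, and U is
   kappa-saturated and strongly kappa-homogeneous. *)
Record monster (K : Type) (U : structure L) : Prop := Monster {
  monster_uncountable : small K [set: nat];
  monster_strong_limit :
    forall A : set K, small K A -> small K [set B : set K | B `<=` A];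
  monster_fsym : small K [set: fsym L];
  monster_rsym : small K [set: rsym L];
  monster_saturated : saturated K U;
  monster_homogeneous : strongly_homogeneous K U }.

End Semantics.

(** * Groups and semigroups carried by subsets *)

Section Groups.
Variable X : Type.

Definition is_group (A : set X) (op : X -> X -> X) :=
  [/\ forall x y, A x -> A y -> A (op x y),
      forall x y z, A x -> A y -> A z -> op x (op y z) = op (op x y) z
    & exists e, [/\ A e,
        forall x, A x -> op e x = x /\ op x e = x
      & forall x, A x -> exists y, [/\ A y, op x y = e & op y x = e]]].

Definition subgroup (A : set X) (op : X -> X -> X) (H : set X) :=
  H `<=` A /\ is_group H op.

Definition setop (op : X -> X -> X) (C D : set X) : set X :=
  [set z | exists x y, [/\ C x, D y & z = op x y]].

Definition left_coset (op : X -> X -> X) (H : set X) (g : X) : set X :=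
  [set op g h | h in H].

Definition left_cosets (A : set X) (op : X -> X -> X) (H : set X)
    : set (set X) :=
  [set left_coset op H g | g in A].

Definition left_ideal (S : set X) (op : X -> X -> X) (I : set X) :=
  [/\ I `<=` S, I !=set0 & forall s x, S s -> I x -> I (op s x)].

Definition minimal_left_ideal (S : set X) (op : X -> X -> X) (I : set X) :=
  left_ideal S op I /\ forall J, left_ideal S op J -> J `<=` I -> J = I.

Definition ellis_subgroup (S : set X) (op : X -> X -> X) (E : set X) :=
  is_group E op /\
  exists I u, [/\ minimal_left_ideal S op I, I u, op u u = u
                & E = [set op u x | x in I]].

End Groups.

Definition group_isomorphism (X Y : Type) (A : set X) (opA : X -> X -> X)
    (B : set Y) (opB : Y -> Y -> Y) (f : X -> Y) :=
  [/\ is_group A opA, is_group B opB, set_bij A B f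
    & forall x y, A x -> A y -> f (opA x y) = opB (f x) (f y)].

(** * Definable groups *)

Section DefinableGroups.
Variables (L : language) (U : structure L) (n : nat).

(* A 0-definable group on n-tuples; the values of [dg_mul] outside of [dg_set]
   are irrelevant. *)
Record definable_group := DefinableGroup {
  dg_set : set ('I_n -> U);
  dg_mul : ('I_n -> U) -> ('I_n -> U) -> 'I_n -> U;
  dg_set_definable : definable set0 dg_set;
  dg_mul_definable : definable set0
    [set w : ('I_n + 'I_n) + 'I_n -> U |
      [/\ dg_set (w \o inl \o inl), dg_set (w \o inl \o inr)
        & w \o inr = dg_mul (w \o inl \o inl) (w \o inl \o inr)]];
  dg_group : is_group dg_set dg_mul }.

Variable G : definable_group.
Local Notation gset := (dg_set G).
Local Notation mul := (dg_mul G).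

(* A left-invariant global Keisler measure concentrated on G. *)
Definition definably_amenable (R : realType) :=
  exists mu : set ('I_n -> U) -> R,
    [/\ forall D, definable setT D -> D `<=` gset -> (0 <= mu D)%R,
        mu gset = 1%R,
        forall D E, definable setT D -> definable setT E ->
          D `<=` gset -> E `<=` gset -> D `&` E = set0 ->
          mu (D `|` E) = (mu D + mu E)%R
      & forall g D, gset g -> definable setT D -> D `<=` gset ->
          mu [set mul g x | x in D] = mu D].

(* S_G(U) *)
Definition SG : set (set (set ('I_n -> U))) :=
  [set p | complete_type setT p /\ p gset].

(* S_G^inv(U, M) *)
Definition SGinv (M : set U) : set (set (set ('I_n -> U))) :=
  [set p | SG p /\ invariant M p].

(* The set defined by phi(x . b), where D is the set defined by phi(x). *)
Definition rmul_preimage (D : set ('I_n -> U)) (b : 'I_n -> U)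
    : set ('I_n -> U) :=
  [set a | gset a /\ D (mul a b)].

(* The product p * q over M.  For M-invariant p, the condition depends neither
   on the tuple d over which D is definable nor on the realization b of
   q|_{Md}. *)
Definition newelski (M : set U) (p q : set (set ('I_n -> U)))
    : set (set ('I_n -> U)) :=
  [set D | exists (m : nat) (d : 'I_m -> U) (b : 'I_n -> U),
    [/\ definable (range d) D, realizes (M `|` range d) q b
      & p (rmul_preimage D b)]].

(* p . c *)
Definition rtranslate (p : set (set ('I_n -> U))) (c : 'I_n -> U)
    : set (set ('I_n -> U)) :=
  [set D | definable setT D /\ p (rmul_preimage D c)].

Definition strong_right_fgeneric (M : set U) (p : set (set ('I_n -> U))) :=
  forall c, gset c -> invariant M (rtranslate p c).

Definition type_definable (K : Type) (H : set ('I_n -> U)) :=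
  exists (A : set U) (F : set (set ('I_n -> U))),
    [/\ small K A, F `<=` definable A & H = \bigcap_(D in F) D].

Definition bounded_type_definable_subgroup (K : Type) (H : set ('I_n -> U)) :=
  [/\ subgroup gset mul H, type_definable K H
    & small K (left_cosets gset mul H)].

(* Under NIP this intersection is itself a type-definable subgroup of bounded
   index, hence the smallest one. *)
Definition G00 (K : Type) : set ('I_n -> U) :=
  \bigcap_(H in bounded_type_definable_subgroup K) H.

Definition quotient00 (K : Type) : set (set ('I_n -> U)) :=
  left_cosets gset mul (G00 K).

(* q(x) entails "x in C", for C type-definable: by saturation, the realizations
   of q in elementary extensions U' of U belong to C(U') if and only if q
   contains all definable supersets of C. *)
Definition concentrates (q : set (set ('I_n -> U))) (C : set ('I_n -> U)) :=
  forall D, definable setT D -> C `<=` D -> q D.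

(* The coset of G00 to which the realizations of q belong. *)
Definition pihat (K : Type) (q : set (set ('I_n -> U))) : set ('I_n -> U) :=
  xget set0 [set C | quotient00 K C /\ concentrates q C].

Definition coset_representatives (K : Type) (B : set ('I_n -> U)) :=
  B `<=` gset /\ forall C, quotient00 K C -> exists! b, B b /\ C b.

End DefinableGroups.

(* Main.v *)
Require Import Defs.
From mathcomp Require Import all_boot all_order all_algebra.
From mathcomp Require Import all_classical all_reals.

(** Let [S] be the stabilizer of [p] under right translation.  As all the
    [p . c] are [M]-invariant, [p . c] only depends on the type of [c] over [M].
    Hence [S] is the set of all [a^-1 b] for [a], [b] realizing [p] over [M],
    which is type-definable by saturation, and its index is at most the number
    of types over [M].  Conversely, [p] concentrates on a coset of every
    type-definable subgroup [H] of bounded index, which forces [S] to be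
    contained in [H].  So [S] is [G00], and [p . c = p . d] if and only if [c]
    and [d] lie in the same coset of [G00].  Moreover [p * q = p . c] for any [c]
    realizing [q] over [M], so that [(p . b) * (p . c) = p . (b a c)] for a fixed
    realization [a] of [p] over [M]: the translates of [p] form a group with
    identity [p . a^-1], and [p . c] is mapped to the coset of [a c]. *)

Set Implicit Arguments.
Unset Strict Implicit.
Unset Printing Implicit Defensive.

Local Open Scope classical_set_scope.

(** * Cardinals *)

(** That [p . c] only depends on the type of [c] over [M] comes from the identity sigma(p . c) =
    sigma(p) . sigma(c): an automorphism over [M] fixes both [p] and [p . c]. That [p] concentrates
    on a coset is a counting argument: otherwise a small set of parameters suffices to exclude every
    coset, and a realization of [p] over it would lie in none. All realizations are taken in [U], of
    restrictions of global types to small sets, so every step fixes beforehand the parameters it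
    needs. In particular [a c] is known to realize [p . c] over a set only if that set contains [c].
    A change of side shapes the algebra: [p . a = p . b] literally says that b a^-1 lies in the
    stabilizer, whereas the quotient consists of left cosets, so the stabilizer has to be shown
    normal before translates can be matched with cosets. The type [p] itself need not be idempotent,
    since p * p = p . a; this is why the identity is the translate by a^-1. The group laws on the
    translates are pulled back from the quotient along [pihat]. *)

Lemma card_le_relP (T U : Type) (A : set T) (B : set U) :
  (A #<= B)%card <->
  exists R : T -> U -> Prop,
    (forall a, A a -> exists2 b, B b & R a b) /\
    (forall a a' b, A a -> A a' -> R a b -> R a' b -> a = a').
Proof.
split=> [/card_leP[f]|[R [Rex Rinj]]].
  exists (fun a b => exists aA : a \in A, b = val (f (SigSub aA))); split.
    move=> a Aa; have aA := mem_set Aa.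
    by exists (val (f (SigSub aA))); [exact/set_mem/valP | exists aA].
  move=> a a' b _ _ [aA ->] [aA' /val_inj].
  by move/(@inj _ _ _ f _ _ (mem_set I) (mem_set I)) => [].
(* Choosing between the subtypes avoids a default value in [U], which may be empty. *)
have [f fR] : {f : A -> B & forall a, R (val a) (val (f a))}.
  apply: (choice (P := fun (a : A) (b : B) => R (val a) (val b))) => a.
  have [b Bb Rab] := Rex _ (set_mem (valP a)).
  by exists (SigSub (mem_set Bb)).
have finj : {in [set: A] &, injective f}.
  move=> a a' _ _ faa'; apply/val_inj/(Rinj _ _ (val (f a))).
  - exact/set_mem/valP.
  - exact/set_mem/valP.
  - exact: fR.
  - by rewrite faa'; exact: fR.
rewrite -(card_le_eql (card_setT A)) -(card_le_eqr (card_setT B)).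
rewrite -(card_le_eql (inj_card_eq finj)).
exact: subset_card_le.
Qed.

Lemma card_le_fun (T U : Type) (A : set T) (B : set U) (f : T -> U) :
  (forall a, A a -> B (f a)) ->
  (forall a a', A a -> A a' -> f a = f a' -> a = a') ->
  (A #<= B)%card.
Proof.
move=> fB finj; apply/card_le_relP; exists (fun a b => b = f a); split.
  by move=> a Aa; exists (f a) => //; exact: fB.
by move=> a a' b Aa Aa' -> /finj; exact.
Qed.

(** Zorn's lemma gives a maximal partial bijection [Z] between [A] and [B]. If it missed a point on
    each side, adding that pair would extend it, so it is total on one side. *)
Lemma card_le_total (T U : Type) (A : set T) (B : set U) :
  (A #<= B)%card \/ (B #<= A)%card.
Proof.
pose P (Z : set (T * U)) := Z `<=` A `*` B /\
  forall x y, Z x -> Z y -> (x.1 = y.1) <-> (x.2 = y.2).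
have [F FP Ftot|Z [[ZAB Zinj] Zmax]] := @Zorn_bigcup _ P.
  split; first by apply: bigcup_sub => X /FP[].
  move=> x y [X FX Xx] [Y FY Yy]; have [XY|YX] := Ftot _ _ FX FY.
    by apply: (FP _ FY).2 => //; exact: XY.
  by apply: (FP _ FX).2 => //; exact: YX.
have [Zl|Zl] := pselect (forall a, A a -> exists b, Z (a, b)).
  left; apply/card_le_relP; exists (fun a b => Z (a, b)); split.
    by move=> a /Zl[b Zab]; exists b => //; exact: (ZAB _ Zab).2.
  by move=> a a' b _ _ Zab Za'b; exact: (Zinj _ _ Zab Za'b).2.
have [Zr|Zr] := pselect (forall b, B b -> exists a, Z (a, b)).
  right; apply/card_le_relP; exists (fun b a => Z (a, b)); split.
    by move=> b /Zr[a Zab]; exists a => //; exact: (ZAB _ Zab).1.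
  by move=> b b' a _ _ Zab Zab'; exact: (Zinj _ _ Zab Zab').1.
move: Zl => /existsNP[a /not_implyP[Aa /forallNP Za]].
move: Zr => /existsNP[b /not_implyP[Bb /forallNP Zb]].
exfalso; apply: (Zmax (Z `|` [set (a, b)])).
  split; first exact: subsetUl.
  by move=> /(_ (a, b)) H; apply: (Za b); apply: H; right.
split; first by move=> x [/ZAB//|->].
move=> [x1 x2] [y1 y2] [Zx|[-> ->]] [Zy|[-> ->]] //=.
- exact: (Zinj (x1, x2) (y1, y2)).
- by split=> E; [case: (Za x2); rewrite -E | case: (Zb x1); rewrite -E].
- by split=> E; [case: (Za y2); rewrite E | case: (Zb y1); rewrite E].
Qed.

Lemma card_le_power (T U : Type) (A : set T) (B : set U) : (A #<= B)%card ->
  ([set X | X `<=` A] #<= [set Y | Y `<=` B])%card.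
Proof.
move=> /card_le_relP[R [Rex Rinj]].
pose f (X : set T) := [set b | B b /\ exists2 a, X a & R a b].
suff fsub X X' : X `<=` A -> X' `<=` A -> f X = f X' -> X `<=` X'.
  apply: (card_le_fun (f := f)) => [X _ b []//|X X' XA XA' E].
  by apply/seteqP; split; apply: fsub.
move=> XA XA' E x Xx; have [b Bb Rxb] := Rex _ (XA _ Xx).
have : f X b by split=> //; exists x.
rewrite E => -[_ [x' Xx' Rx'b]].
by rewrite (Rinj _ _ _ (XA _ Xx) (XA' _ Xx') Rxb Rx'b).
Qed.


(** * Small sets *)

Section Small.
Variables (L : language) (K : Type) (U : structure L).
Hypothesis U_monster : monster K U.

Lemma small_le (T T' : Type) (A : set T) (B : set T') :
  small K B -> (A #<= B)%card -> small K A.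
Proof. by move=> sB AB KA; apply: sB; exact: card_le_trans AB. Qed.

(** [monster_strong_limit] speaks only of subsets of [K]; this copies a small set into [K] so that
    it applies. *)
Lemma small_subset (T : Type) (A : set T) :
  small K A -> exists2 B : set K, small K B & (A #= B)%card.
Proof.
move=> sA; have [//|/card_subP[B BA _]] := card_le_total [set: K] A.
exists B; last by rewrite card_eq_sym.
by apply: small_le sA _; case/card_eqPle: BA.
Qed.

Lemma small_power (T : Type) (A : set T) :
  small K A -> small K [set X | X `<=` A].
Proof.
move=> /small_subset[B sB /card_eqPle[AB _]].
exact: small_le (monster_strong_limit U_monster sB) (card_le_power AB).
Qed.

(* Kuratowski pairs embed [A `*` A] into the double power set of [A]. *)
Lemma small_setX_diag (T : Type) (A : set T) : small K A -> small K (A `*` A).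
Proof.
move=> sA; apply: small_le (small_power (small_power sA)) _.
pose f (x : T * T) := [set X | X = [set x.1] \/ X = [set x.1] `|` [set x.2]].
apply: (card_le_fun (f := f)) => [[x y] [/= Ax Ay] X [->|->] z /=|].
- by move=> ->.
- by case=> ->.
move=> [x y] [x' y'] _ _ E.
have E1 X : f (x, y) X <-> f (x', y') X by rewrite E.
rewrite /f /= in E1.
have xx' : x' = x.
  have [E2|E2] := (E1 [set x]).1 (or_introl erefl).
    have x'1 : [set x'] x' by [].
    by rewrite -E2 in x'1.
  have x'2 : ([set x'] `|` [set y']) x' by left.
  by rewrite -E2 in x'2.
subst x'; congr pair.
have yE : y = x \/ y = y'.
  have y2 : ([set x] `|` [set y]) y by right.
  have [E2|E2] := (E1 _).1 (or_intror erefl); rewrite E2 in y2; first by left.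
  by case: y2; [left|right].
have y'E : y' = x \/ y' = y.
  have y2 : ([set x] `|` [set y']) y' by right.
  have [E2|E2] := (E1 _).2 (or_intror erefl); rewrite E2 in y2; first by left.
  by case: y2; [left|right].
by case: yE y'E => [->|->] [] // ->.
Qed.

Lemma small_nat : small K [set: nat].
Proof. exact: monster_uncountable U_monster. Qed.

Lemma small_finite (T : Type) (A : set T) : finite_set A -> small K A.
Proof. by move=> /finite_set_countable; apply: small_le; exact: small_nat. Qed.

Lemma small_common (T T' : Type) (A : set T) (B : set T') :
  small K A -> small K B ->
  exists C : set K, [/\ small K C, (A #<= C)%card & (B #<= C)%card].
Proof.
move=> sA sB; have [AB|BA] := card_le_total A B.
  have [C sC /card_eqPle[BC _]] := small_subset sB.
  by exists C; split=> //; exact: card_le_trans BC.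
have [C sC /card_eqPle[AC _]] := small_subset sA.
by exists C; split=> //; exact: card_le_trans AC.
Qed.

Lemma small_setX (T T' : Type) (A : set T) (B : set T') :
  small K A -> small K B -> small K (A `*` B).
Proof.
move=> sA sB; have [C [sC AC BC]] := small_common sA sB.
apply: small_le (small_setX_diag sC) _.
move: AC BC => /card_le_relP[R [Rex Rinj]] /card_le_relP[R' [Rex' Rinj']].
apply/card_le_relP; exists (fun x y => R x.1 y.1 /\ R' x.2 y.2); split.
  move=> [a b] [/= /Rex[c Cc Rac] /Rex'[c' Cc' Rbc']].
  by exists (c, c').
move=> [a b] [a' b'] [c c'] [/= Aa Bb] [/= Aa' Bb'] [/= Rac Rbc] [Rac' Rbc'].
by congr pair; [exact: Rinj Rac Rac' | exact: Rinj' Rbc Rbc'].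
Qed.

Lemma small_setU (T : Type) (A B : set T) :
  small K A -> small K B -> small K (A `|` B).
Proof.
move=> sA sB; have [C [sC AC BC]] := small_common sA sB.
apply: small_le (small_setX sC small_nat) _.
move: AC BC => /card_le_relP[R [Rex Rinj]] /card_le_relP[R' [Rex' Rinj']].
(* The tag 0 or 1 records which of the two injections into [C] was used; points in both sets go with
   [A]. *)
apply/card_le_relP; exists (fun x y => (A x /\ R x y.1 /\ y.2 = 0) \/
  (~ A x /\ R' x y.1 /\ y.2 = 1)); split.
  move=> a ABa; have [Aa|nAa] := pselect (A a).
    by have [c Cc Rac] := Rex _ Aa; exists (c, 0) => //; left.
  have Ba : B a by case: ABa.
  by have [c Cc Rac] := Rex' _ Ba; exists (c, 1) => //; right.
move=> a a' [c i] ABa ABa' /=.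
move=> [[Aa [Rac ->]]|[nAa [Rac ->]]] [[Aa' [Rac' //]]|[nAa' [Rac' //]]] _.
  exact: Rinj Rac Rac'.
by apply: Rinj' Rac Rac' => //; [case: ABa|case: ABa'].
Qed.

Lemma small_sum (T T' : Type) :
  small K [set: T] -> small K [set: T'] -> small K [set: T + T'].
Proof.
move=> sT sT'; have := small_setU (small_le sT (card_image_le inl setT))
  (small_le sT' (card_image_le inr setT)).
move=> s; apply: small_le s _.
by apply: subset_card_le => -[x|x] _; [left|right]; exists x.
Qed.

(** A sequence is determined by its graph, a subset of the small set of pairs (index, entry). *)
Lemma small_seq (T : Type) : small K [set: T] -> small K [set: seq T].
Proof.
move=> sT; have := small_power (small_setX small_nat sT).
move=> sP; apply: small_le sP _.
pose f (s : seq T) := [set x | onth s x.1 = Some x.2].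
apply: (card_le_fun (f := f)) => // s s' _ _ E.
have {}E i x : onth s i = Some x <-> onth s' i = Some x.
  by have -> : (onth s i = Some x) = f s (i, x) by []; rewrite E.
elim: s s' E => [|x s IH] [|y s'] E //.
- by have := (E 0 y).2 erefl.
- by have := (E 0 x).1 erefl.
have [->] := (E 0 x).1 erefl.
by congr cons; apply: IH => i z; exact: (E i.+1 z).
Qed.

End Small.

(** * Counting formulas *)

Section Coding.
Variable L : language.

(** The alphabet for formulas in Polish notation. Natural numbers serve both as constructor tags and
    as variable indices; a function or relation symbol fixes its arity, so no brackets are
    required. *)
Definition symbol : Type := nat + (Defs.fsym L + rsym L).

Fixpoint term_code (V : Type) (e : V -> nat) (t : term L V) : seq symbol :=
  match t with
  | Var x => [:: inl 0; inl (e x)]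
  | App f args => inr (inl f) ::
      flatten [seq term_code e (args i) | i <- enum 'I_(farity f)]
  end.

(** Variables are numbered in de Bruijn style: under a quantifier the bound one gets 0 and the
    others move up by one. *)
Fixpoint formula_code (V : Type) (e : V -> nat) (phi : formula L V) :
    seq symbol :=
  match phi with
  | FBot => [:: inl 1]
  | FEq s t => inl 2 :: term_code e s ++ term_code e t
  | FRel r args => inr (inr r) ::
      flatten [seq term_code e (args i) | i <- enum 'I_(rarity r)]
  | FImp psi chi => inl 3 :: formula_code e psi ++ formula_code e chi
  | FAll psi => inl 4 ::
      formula_code (fun o => if o is Some x then (e x).+1 else 0) psi
  end.

(** Arguments are concatenated without separators, so unique readability is stated with arbitrary
    remainders [r] and [r']: reading off one code must also determine where the next begins. *)
Lemma flatten_code_inj (X Y : Type) (k : nat) (code : X -> seq Y)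
    (a b : 'I_k -> X) (r r' : seq Y) :
  (forall i t s s', code (a i) ++ s = code t ++ s' -> a i = t /\ s = s') ->
  flatten [seq code (a i) | i <- enum 'I_k] ++ r =
  flatten [seq code (b i) | i <- enum 'I_k] ++ r' -> a = b /\ r = r'.
Proof.
move=> inj_a.
suff H (l : seq 'I_k) : flatten [seq code (a i) | i <- l] ++ r =
    flatten [seq code (b i) | i <- l] ++ r' ->
    (forall i, i \in l -> a i = b i) /\ r = r'.
  move=> /H[ab ->]; split=> //; apply/funext => i.
  by apply: ab; rewrite mem_enum.
elim: l => [|i l IH] /=; first by move=> ->.
rewrite -!catA => /inj_a[abi /IH[ab ->]]; split=> // j.
by rewrite inE => /predU1P[->|/ab].
Qed.

Lemma term_code_inj (V : Type) (e : V -> nat) : injective e ->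
  forall (t t' : term L V) r r',
    term_code e t ++ r = term_code e t' ++ r' -> t = t' /\ r = r'.
Proof.
move=> e_inj; elim=> [x|f a IH] [x'|f' a'] r r' //=.
  by case=> /e_inj -> ->.
case=> ff'; subst f' => /flatten_code_inj[i t s s'|-> ->] //; exact: IH.
Qed.

Lemma formula_code_inj (V : Type) (e : V -> nat) : injective e ->
  forall (phi phi' : formula L V) r r',
    formula_code e phi ++ r = formula_code e phi' ++ r' ->
    phi = phi' /\ r = r'.
Proof.
move=> + phi; elim: phi e => {V}
  [V|V s t|V R a|V phi IH chi IH'|V phi IH] e e_inj
  [|s' t'|R' a'|phi' chi'|phi'] r r' //=.
- by case.
- case; rewrite -!catA.
  by move=> /(term_code_inj e_inj)[-> /(term_code_inj e_inj)[-> ->]].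
- case=> RR'; subst R' => /flatten_code_inj[i t s s'|-> ->] //.
  exact: term_code_inj.
- by case; rewrite -!catA => /(IH _ e_inj)[-> /(IH' _ e_inj)[-> ->]].
- by case=> /IH[|-> ->] //; move=> [x|] [y|] // [/e_inj ->].
Qed.

(** A definable set is recovered from the number of its parameters, the code of a formula and the
    graph of the parameter tuple, and each of these ranges over a small set. *)
Lemma small_definable (K : Type) (U : structure L) (n : nat) (A : set U) :
  monster K U -> small K A ->
  small K (@definable L U 'I_n A).
Proof.
move=> mon sA.
have s_sym : small K [set: symbol].
  apply: (small_sum mon (small_nat mon)); apply: (small_sum mon).
    exact: monster_fsym mon.
  exact: monster_rsym mon.
have := small_setX mon (small_nat mon) (small_setX mon (small_seq mon s_sym)
  (small_power mon (small_setX mon (small_nat mon) sA))).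
move=> sP; apply: small_le sP _.
(* Object variables get even numbers and parameter variables odd ones. *)
pose e m (x : 'I_n + 'I_m) : nat :=
  match x with inl i => i.*2 | inr j => j.*2.+1 end.
have e_inj m : injective (@e m).
  move=> [i|i] [j|j] /= E.
  - by congr inl; apply: ord_inj; apply: double_inj.
  - by have := congr1 odd E; rewrite /= !odd_double.
  - by have := congr1 odd E; rewrite /= !odd_double.
  - by congr inr; apply: ord_inj; apply: double_inj; case: E.
apply/card_le_relP.
(* A relation, because one set has many presentations; it is enough that a presentation determines
   the set. *)
exists (fun D x => exists (m : nat) (phi : formula L ('I_n + 'I_m)) c,
  D = [set x | sat (concat x c) phi] /\
  x = (m, (formula_code (@e m) phi, [set ic | exists i, ic = (val i, c i)]))).
split.
  move=> D [m [phi [c [Ac DE]]]].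
  exists (m, (formula_code (@e m) phi, [set ic | exists i, ic = (val i, c i)])).
    split=> //; split=> //= ic [i ->]; split=> //; exact: Ac.
  by exists m, phi, c.
move=> D D' x _ _ [m [phi [c [-> ->]]]] [m' [phi' [c' [-> [mm' E E']]]]].
subst m'.
have [-> _] : phi = phi' /\ [::] = [::] :> seq symbol.
  by apply: (formula_code_inj (@e_inj m)); rewrite !cats0.
suff -> : c = c' by [].
apply/funext => i.
have : [set ic | exists i, ic = (val i, c i)] (val i, c i) by exists i.
by rewrite E' => -[j [/ord_inj -> ->]].
Qed.

End Coding.

(** * Definable sets *)

Section Definable.
Variable L : language.

Definition I0_rect (T : Type) (i : 'I_0) : T := False_rect T (notF (ltn_ord i)).

Fixpoint term_rename (V W : Type) (f : V -> W) (t : term L V) : term L W :=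
  match t with
  | Var x => Var (f x)
  | App g args => App g (fun i => term_rename f (args i))
  end.

Fixpoint formula_rename (V W : Type) (f : V -> W) (phi : formula L V) :
    formula L W :=
  match phi with
  | FBot => FBot
  | FEq s t => FEq (term_rename f s) (term_rename f t)
  | FRel r args => FRel r (fun i => term_rename f (args i))
  | FImp psi chi => FImp (formula_rename f psi) (formula_rename f chi)
  | FAll psi => FAll (formula_rename (omap f) psi)
  end.

Variable U : structure L.

Lemma eval_rename (V W : Type) (f : V -> W) (v : W -> U) (t : term L V) :
  eval v (term_rename f t) = eval (v \o f) t.
Proof. by elim: t => //= g args IH; congr (fint _ _); exact/funext. Qed.

Lemma sat_rename (V W : Type) (f : V -> W) (v : W -> U) (phi : formula L V) :
  sat v (formula_rename f phi) <-> sat (v \o f) phi.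
Proof.
elim: phi W f v => {V} [V|V s t|V r args|V phi IH psi IH'|V phi IH] W f v //=.
- by rewrite !eval_rename.
- suff -> : (fun i => eval v (term_rename f (args i))) =
            (fun i => eval (v \o f) (args i)) by [].
  by apply/funext => i; exact: eval_rename.
- by rewrite IH IH'.
- suff E a : extend v a \o omap f = extend (v \o f) a.
    by split=> H a; have := H a; rewrite IH E.
  by apply/funext => -[].
Qed.

Implicit Types (A B : set U).

Lemma definable_subset (V : Type) A B (D : set (V -> U)) :
  A `<=` B -> definable A D -> definable B D.
Proof.
by move=> AB [m [phi [c [Ac ->]]]]; exists m, phi, c; split=> // i; exact/AB.
Qed.

Lemma definable_setT (V : Type) A (D : set (V -> U)) :
  definable A D -> definable setT D.
Proof. exact: definable_subset. Qed.

Lemma definable_preimage (V W : Type) (f : V -> W) A (D : set (V -> U)) :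
  definable A D -> definable A [set y : W -> U | D (y \o f)].
Proof.
move=> [m [phi [c [Ac ->]]]].
exists m, (formula_rename
  (fun x => match x with inl i => inl (f i) | inr j => inr j end) phi), c.
split=> //; apply/seteqP; split=> y /=; rewrite sat_rename;
  by congr (sat _ _); apply/funext => -[].
Qed.

Lemma definable_params (V : Type) (k : nat) (c : 'I_k -> U) A
    (D : set (V + 'I_k -> U)) :
  (forall i, A (c i)) -> definable A D ->
  definable A [set x : V -> U | D (concat x c)].
Proof.
move=> Ac [m [phi [d [Ad ->]]]].
pose f (x : (V + 'I_k) + 'I_m) : V + 'I_(k + m) := match x with
  | inl (inl i) => inl i | inl (inr j) => inr (lshift m j)
  | inr j => inr (rshift k j) end.
exists (k + m), (formula_rename f phi), (concat c d \o @fintype.split _ _).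
split.
  by move=> i /=; case: (fintype.split i).
apply/seteqP; split=> x /=; rewrite sat_rename;
  congr (sat _ _); apply/funext => -[[i|j]|j] //=;
  by rewrite ?(unsplitK (inl j)) ?(unsplitK (inr j)).
Qed.

Lemma definable_common (V : Type) A (D E : set (V -> U)) :
  definable A D -> definable A E ->
  exists (m : nat) (c : 'I_m -> U) (phi psi : formula L (V + 'I_m)),
    [/\ forall i, A (c i), D = [set x | sat (concat x c) phi]
      & E = [set x | sat (concat x c) psi]].
Proof.
move=> [m [phi [c [Ac ->]]]] [k [psi [d [Ad ->]]]].
exists (m + k), (concat c d \o @fintype.split _ _),
  (formula_rename (fun x : V + 'I_m => match x with inl i => inl i
     | inr j => inr (lshift k j) end) phi),
  (formula_rename (fun x : V + 'I_k => match x with inl i => inl i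
     | inr j => inr (rshift m j) end) psi).
split; first by move=> i /=; case: (fintype.split i).
  apply/seteqP; split=> x /=; rewrite sat_rename;
  congr (sat _ _); apply/funext => -[i|j] //=;
  by rewrite ?(unsplitK (inl j)).
apply/seteqP; split=> x /=; rewrite sat_rename;
  congr (sat _ _); apply/funext => -[i|j] //=;
  by rewrite ?(unsplitK (inr j)).
Qed.

Lemma definable_set0 (V : Type) A : definable A (set0 : set (V -> U)).
Proof.
exists 0, FBot, (@I0_rect U); split; first by case.
by apply/seteqP; split.
Qed.

Lemma definable_imp (V : Type) A (D E : set (V -> U)) :
  definable A D -> definable A E -> definable A [set x | D x -> E x].
Proof.
move=> dD /(definable_common dD)[m [c [phi [psi [Ac -> ->]]]]].
by exists m, (FImp phi psi), c.
Qed.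

Lemma definable_setC (V : Type) A (D : set (V -> U)) :
  definable A D -> definable A (~` D).
Proof. by move=> dD; exact: definable_imp dD (definable_set0 _ _). Qed.

Lemma definable_setI (V : Type) A (D E : set (V -> U)) :
  definable A D -> definable A E -> definable A (D `&` E).
Proof.
move=> dD dE.
have := definable_setC (definable_imp dD (definable_setC dE)).
congr (definable _ _); apply/seteqP; split=> x /=.
  by move=> /not_implyP[Dx /contrapT].
by move=> [Dx Ex] /(_ Dx).
Qed.

Lemma definable_ex1 (V : Type) A (D : set (option V -> U)) :
  definable A D -> definable A [set x | exists a, D (extend x a)].
Proof.
move=> /definable_setC[m [phi [c [Ac DE]]]].
have -> : [set x | exists a, D (extend x a)] =
    ~` [set x : V -> U | forall a, (~` D) (extend x a)].
  apply/seteqP; split=> x /=; first by move=> [a Da] /(_ a).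
  by move=> /existsNP[a /contrapT]; exists a.
apply: definable_setC.
exists m, (FAll (formula_rename (fun x => match x with
  | inl (Some i) => Some (inl i) | inl None => None
  | inr j => Some (inr j) end) phi)), c; split=> //.
rewrite DE; apply/seteqP; split=> x /= H a; have := H a; rewrite sat_rename;
  by congr (sat _ _); apply/funext => -[[]|].
Qed.

Lemma definable_ex (V : Type) (k : nat) A (D : set (V + 'I_k -> U)) :
  definable A D -> definable A [set x | exists y, D (concat x y)].
Proof.
elim: k V D => [|k IH] V D dD.
  pose f (x : V + 'I_0) : V :=
    match x with inl i => i | inr j => I0_rect V j end.
  have := definable_preimage f dD; congr (definable _ _).
  apply/seteqP; split=> x /=.
    move=> Dx; exists (x \o f \o inr); congr D: Dx.
    by apply/funext => -[i|[]].
  by move=> [y Dy]; congr D: Dy; apply/funext => -[i|[]].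
(* The first of the [k.+1] quantified variables becomes [None], to be bound by [definable_ex1]; the
   induction hypothesis binds the rest. *)
pose f (x : V + 'I_k.+1) : option V + 'I_k := match x with
  | inl i => inl (Some i)
  | inr j => if unlift ord0 j is Some j' then inr j' else inl None end.
have := definable_ex1 (IH _ _ (definable_preimage f dD)).
congr (definable _ _); apply/seteqP; split=> x /=.
  move=> [a [y Dy]].
  exists (fun j => if unlift ord0 j is Some j' then y j' else a).
  congr D: Dy; apply/funext => -[i|j] //=; by case: unliftP.
move=> [y Dy]; exists (y ord0), (y \o lift ord0).
by congr D: Dy; apply/funext => -[i|j] //=; case: unliftP => [j' ->|->].
Qed.

(** Serves [type_homogeneous], where a tuple mixes entries of [b] with elements of [A] in any order:
    [k] tells which places are variables and which are parameters. *)
Lemma definable_partial_eval (V : Type) (m : nat) A (k : 'I_m -> V + U)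
    (phi : formula L 'I_m) :
  (forall j u, k j = inr u -> A u) ->
  definable A [set x : V -> U |
    sat (fun j => match k j with inl i => x i | inr u => u end) phi].
Proof.
move=> Ak.
(* The parameter tuple has length [m], so its places for variables are filled with a dummy [a] from
   [A]; if [A] is empty, every place is a variable. *)
have [[a Aa]|nA] := pselect (exists a, A a).
  exists m, (formula_rename (fun j =>
    match k j with inl i => inl i | inr _ => inr j end) phi),
    (fun j => match k j with inl _ => a | inr u => u end); split.
    by move=> j; case E: (k j) => [i|u] //; exact: Ak E.
  apply/seteqP; split=> x /=; rewrite sat_rename; congr (sat _ _);
    by apply/funext => j /=; case E: (k j) => //=; rewrite E.
have [g gk] : {g : 'I_m -> V & forall j, k j = inl (g j)}.
  apply: (choice (P := fun j i => k j = inl i)) => j.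
  case E: (k j) => [i|u]; first by exists i.
  by case: nA; exists u; exact: Ak E.
exists 0, (formula_rename (inl \o g) phi), (@I0_rect U).
split; first by case.
apply/seteqP; split=> x /=; rewrite sat_rename; congr (sat _ _);
  by apply/funext => j /=; rewrite gk.
Qed.

End Definable.

(** * Automorphisms and types *)

Section Automorphisms.
Variables (L : language) (U : structure L).
Implicit Types (A B : set U) (sigma : U -> U).

Lemma eval_automorphism sigma (V : Type) (v : V -> U) (t : term L V) :
  automorphism sigma -> eval (sigma \o v) t = sigma (eval v t).
Proof.
move=> [_ sf _]; elim: t => //= f args IH; rewrite sf; congr (fint _ _).
exact/funext.
Qed.

Lemma sat_automorphism sigma (V : Type) (v : V -> U) (phi : formula L V) :
  automorphism sigma -> (sat (sigma \o v) phi <-> sat v phi).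
Proof.
move=> aut; have [[tau sK tK] _ sr] := aut.
elim: phi v => {V} [V|V s t|V r args|V phi IH psi IH'|V phi IH] v //=.
- rewrite !eval_automorphism //; split=> [/(can_inj sK) //|E].
  by rewrite E.
- suff -> : (fun i => eval (sigma \o v) (args i)) =
            sigma \o (fun i => eval v (args i)).
    by split; [apply: (sr _ _).2 | apply: (sr _ _).1].
  by apply/funext => i; exact: eval_automorphism.
- by rewrite IH IH'.
- have E a : extend (sigma \o v) (sigma a) = sigma \o extend v a.
    by apply/funext => -[].
  split=> H a; first by apply/IH; rewrite -E; exact: H.
  by rewrite -(tK a) E; apply/IH.
Qed.

Lemma automorphism_inv sigma tau :
  automorphism sigma -> cancel sigma tau -> cancel tau sigma ->
  automorphism tau.
Proof.
move=> [_ sf sr] sK tK; split; first by exists sigma.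
  move=> f args; apply: (can_inj sK); rewrite tK sf; congr (fint _ _).
  by apply/funext => i /=; rewrite tK.
move=> r args; rewrite (sr r (tau \o args)).
suff -> : sigma \o (tau \o args) = args by [].
by apply/funext => i /=; rewrite tK.
Qed.

Lemma automorphism_over_inv A sigma : automorphism_over A sigma ->
  exists tau, [/\ automorphism_over A tau, cancel sigma tau
                & cancel tau sigma].
Proof.
move=> [aut fixA]; have [[tau sK tK] _ _] := aut.
exists tau; split=> //; split; first exact: automorphism_inv tK.
by move=> a /fixA {1}<-.
Qed.

Lemma image_compE sigma tau (V : Type) (D : set (V -> U)) :
  cancel sigma tau -> cancel tau sigma ->
  [set sigma \o x | x in D] = [set x | D (tau \o x)].
Proof.
move=> sK tK; apply/seteqP; split=> [_ [x Dx <-] /=|x /= Dx].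
  by congr D: Dx; apply/funext => i /=; rewrite sK.
by exists (tau \o x) => //; apply/funext => i /=; rewrite tK.
Qed.

Lemma comp_image sigma (V : Type) (D : set (V -> U)) (x : V -> U) :
  automorphism sigma -> [set sigma \o x | x in D] (sigma \o x) <-> D x.
Proof.
move=> [[tau sK tK] _ _]; rewrite (image_compE D sK tK) /=.
suff -> : tau \o (sigma \o x) = x by [].
by apply/funext => i /=; rewrite sK.
Qed.

Lemma definable_image sigma A B (V : Type) (D : set (V -> U)) :
  automorphism sigma -> (forall a, A a -> B (sigma a)) ->
  definable A D -> definable B [set sigma \o x | x in D].
Proof.
move=> aut AB [m [phi [c [Ac ->]]]]; have [[tau sK tK] _ _] := aut.
exists m, phi, (sigma \o c); split; first by move=> i; exact/AB.
rewrite (image_compE _ sK tK); apply/seteqP; split=> x /=;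
  rewrite -(sat_automorphism (concat (tau \o x) c) phi aut);
  by congr (sat _ _); apply/funext => -[i|i] //=; rewrite tK.
Qed.

Lemma definable_automorphism sigma A (V : Type) (D : set (V -> U)) x :
  automorphism_over A sigma -> definable A D -> D (sigma \o x) <-> D x.
Proof.
move=> [aut fixA] [m [phi [c [Ac ->]]]] /=.
rewrite -(sat_automorphism (concat x c) phi aut).
suff -> : concat (sigma \o x) c = sigma \o concat x c by [].
by apply/funext => -[i|i] //=; rewrite fixA.
Qed.

Lemma automorphism_over_subset A B sigma :
  A `<=` B -> automorphism_over B sigma -> automorphism_over A sigma.
Proof. by move=> AB [? fixB]; split=> // a /AB/fixB. Qed.

End Automorphisms.

(** * Realizing types and conjugating realizations in the monster model *)

Section Types.
Variables (L : language) (K : Type) (U : structure L).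
Hypothesis U_monster : monster K U.
Implicit Types (A B M : set U).

Lemma small_params A (k : nat) (c : 'I_k -> U) :
  small K A -> small K (A `|` range c).
Proof.
move=> sA; apply: (small_setU U_monster) => //.
apply: (small_finite U_monster); apply: finite_image; exact: finite_finset.
Qed.

Lemma type_realized (n : nat) A (q : set (set ('I_n -> U))) :
  complete_type setT q -> small K A -> exists b, realizes A q b.
Proof.
move=> [_ q0 qI qS qC] sA.
have [|b bq] := monster_saturated U_monster sA
    (p := q `&` @definable L U _ A); last first.
  by exists b => D qD dD; apply: bq.
split.
- by move=> D [].
- by case.
- by move=> D E [qD dD] [qE dE]; split; [exact: qI | exact: definable_setI].
- move=> D E [qD dD] dE DE; split=> //; apply: qS DE => //.
  exact: definable_setT dE.
- move=> D dD; have [qD|qD] := qC D (definable_setT dD); [left|right] => //.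
  by split=> //; exact: definable_setC.
Qed.

(** [saturated] is about complete types. The filter generated by [F] extends to an ultrafilter on
    all sets of tuples, whose trace on the [A]-definable sets is a complete type containing [F]. *)
Lemma saturation (n : nat) A (F : set (set ('I_n -> U))) :
  small K A -> F !=set0 -> F `<=` definable A ->
  (forall D, F D -> D !=set0) ->
  (forall D E, F D -> F E -> exists2 C, F C & C `<=` D `&` E) ->
  exists b, forall D, F D -> D b.
Proof.
move=> sA F0 FA Fne FI.
have Ff : ProperFilter (filter_from F id).
  by apply: filter_from_proper => //; exact: filter_from_filter.
have [W [Wu FW]] := ultraFilterLemma Ff.
have WP : ProperFilter W by exact: ultra_proper.
have [|b bW] := monster_saturated U_monster sA (p := W `&` @definable L U _ A).
  split.
  - by move=> D [].
  - by move=> [/filter_not_empty].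
  - move=> D E [WD dD] [WE dE].
    by split; [exact: filterI | exact: definable_setI].
  - by move=> D E [WD dD] dE DE; split=> //; apply: filterS WD.
  - move=> D dD; have [WD|WD] := in_ultra_setVsetC D Wu; [left|right] => //.
    by split=> //; exact: definable_setC.
exists b => D FD; apply: bW; last exact: FA.
by split; [apply: FW; exists D | exact: FA].
Qed.

Lemma realizes_subset (V : Type) A B (q : set (set (V -> U))) b :
  A `<=` B -> realizes B q b -> realizes A q b.
Proof.
by move=> AB bq D qD dD; apply: bq => //; exact: definable_subset dD.
Qed.

(** Homogeneity asks for a map on elements, but [b] may repeat entries or meet [A]. Hence the
    relation [R], the identity on [A] together with the pairs (b i, b' i): it is shown to be
    elementary, then single-valued, and only then turned into a map. *)
Lemma type_homogeneous (n : nat) A (b b' : 'I_n -> U) :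
  small K A -> (forall D, definable A D -> D b -> D b') ->
  exists2 sigma, automorphism_over A sigma & sigma \o b = b'.
Proof.
move=> sA bb'.
have bb'_iff D : definable A D -> D b <-> D b'.
  move=> dD; split; first exact: bb'.
  by move=> Db'; apply: contrapT => Db; exact: (bb' _ (definable_setC dD) Db).
pose R u w := (A u /\ w = u) \/ exists i, u = b i /\ w = b' i.
have R_elem m (phi : formula L 'I_m) a a' :
    (forall j, R (a j) (a' j)) -> sat a phi <-> sat a' phi.
  move=> aR.
  have [k kP] : {k : 'I_m -> 'I_n + U & forall j, match k j with
      | inl i => a j = b i /\ a' j = b' i
      | inr u => [/\ A u, a j = u & a' j = u] end}.
    apply: (choice (P := fun j k => match k with
      | inl i => a j = b i /\ a' j = b' i
      | inr u => [/\ A u, a j = u & a' j = u] end)) => j.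
    have [[Aa ->]|[i [-> ->]]] := aR j; first by exists (inr (a j)).
    by exists (inl i).
  have Ak j u : k j = inr u -> A u by move=> E; have := kP j; rewrite E => -[].
  have := bb'_iff _ (definable_partial_eval phi Ak); rewrite /=.
  suff -> : (fun j => match k j with inl i => b i | inr u => u end) = a.
    suff -> : (fun j => match k j with inl i => b' i | inr u => u end) = a'.
      by [].
    by apply/funext => j; have := kP j; case: (k j) => [i []|u []].
  by apply/funext => j; have := kP j; case: (k j) => [i []|u []].
(* Elementarity for the formula x = y, with (u, u) related to (w, w'). *)
have R_fun u w w' : R u w -> R u w' -> w = w'.
  move=> Rw Rw'.
  have /(R_elem _ (FEq (Var ord0) (Var ord_max))) [E _] : forall j : 'I_2,
      R ((fun=> u) j) ((fun j : 'I_2 => if j == ord0 then w else w') j).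
    by move=> j; case: ifP.
  exact: E.
have [f fR] : {f : U -> U & forall u, (A `|` range b) u -> R u (f u)}.
  apply: (choice (P := fun u w => (A `|` range b) u -> R u w)) => u.
  have [[Au|[i _ <-]]|nAu] := pselect ((A `|` range b) u).
  - by exists u; left.
  - by exists (b' i); right; exists i.
  - by exists u.
have [|sigma [aut sf]] := monster_homogeneous U_monster (f := f)
    (small_params (c := b) sA).
  by move=> m phi a Aa; apply: R_elem => j; exact: fR.
exists sigma.
  split=> // a Aa; have Aba : (A `|` range b) a by left.
  by rewrite sf //; apply: R_fun (fR _ Aba) _; left.
apply/funext => i; have Aba : (A `|` range b) (b i) by right; exists i.
by rewrite /= sf //; apply: R_fun (fR _ Aba) _; right; exists i.
Qed.

Lemma realizes_conjugate (n : nat) A (q : set (set ('I_n -> U))) b b' :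
  complete_type setT q -> small K A -> realizes A q b -> realizes A q b' ->
  exists2 sigma, automorphism_over A sigma & sigma \o b = b'.
Proof.
move=> [_ _ _ _ qC] sA bq b'q; apply: type_homogeneous => // D dD Db.
have [qD|qD] := qC D (definable_setT dD); first exact: b'q.
by have := bq _ qD (definable_setC dD).
Qed.

(** Testing sigma(b) against [D] amounts to testing [b] against the preimage of [D] under sigma,
    which is defined over [A] and still belongs to [q] by invariance. *)
Lemma realizes_image (V : Type) A B M (q : set (set (V -> U))) sigma b :
  automorphism_over M sigma -> Defs.invariant M q ->
  (forall u, B u -> exists2 a, A a & sigma a = u) ->
  realizes A q b -> realizes B q (sigma \o b).
Proof.
move=> sM qM BA bq D qD dD.
have [tau [tM sK tK]] := automorphism_over_inv sM.
have := bq [set tau \o x | x in D].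
rewrite (image_compE D tK sK) /=; apply.
  by rewrite -(image_compE D tK sK); exact: (qM _ tM D).1.
rewrite -(image_compE D tK sK); apply: definable_image dD; first exact: tM.1.
by move=> u /BA[a Aa <-]; rewrite sK.
Qed.

End Types.

(** * Definable groups *)

Section GroupOperations.
Variables (L : language) (U : structure L) (n : nat) (G : definable_group U n).
Local Notation gset := (dg_set G).
Local Notation mul := (dg_mul G).

Lemma dg_ops_exist : exists ops : ('I_n -> U) * (('I_n -> U) -> 'I_n -> U),
  [/\ gset ops.1, forall x, gset x -> mul ops.1 x = x /\ mul x ops.1 = x
    & forall x, gset x ->
        [/\ gset (ops.2 x), mul x (ops.2 x) = ops.1 & mul (ops.2 x) x = ops.1]].
Proof.
have [_ _ [e [Ge e1 eV]]] := dg_group G.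
have [ginv ginvP] : {ginv : ('I_n -> U) -> 'I_n -> U & forall x, gset x ->
    [/\ gset (ginv x), mul x (ginv x) = e & mul (ginv x) x = e]}.
  apply: (choice (P := fun x y => gset x ->
    [/\ gset y, mul x y = e & mul y x = e])) => x.
  have [/eV[y]|nGx] := pselect (gset x); first by exists y.
  by exists x.
by exists (e, ginv).
Qed.

Definition dg_one : 'I_n -> U := (projT1 (cid dg_ops_exist)).1.
Definition dg_inv : ('I_n -> U) -> 'I_n -> U := (projT1 (cid dg_ops_exist)).2.
Local Notation ginv := dg_inv.

Lemma dg_mulS a b : gset a -> gset b -> gset (mul a b).
Proof. by have [+ _ _] := dg_group G; exact. Qed.

Lemma dg_mulA a b c : gset a -> gset b -> gset c ->
  mul a (mul b c) = mul (mul a b) c.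
Proof. by have [_ + _] := dg_group G; exact. Qed.

Lemma dg_oneS : gset dg_one.
Proof. by rewrite /dg_one; case: cid => ops []. Qed.

Lemma dg_mul1 a : gset a -> mul dg_one a = a.
Proof. by rewrite /dg_one; case: cid => ops [/= _ H _] /H[]. Qed.

Lemma dg_mulr1 a : gset a -> mul a dg_one = a.
Proof. by rewrite /dg_one; case: cid => ops [/= _ H _] /H[]. Qed.

Lemma dg_invS a : gset a -> gset (ginv a).
Proof. by rewrite /dg_inv; case: cid => ops [/= _ _ H] /H[]. Qed.

Lemma dg_mulV a : gset a -> mul a (ginv a) = dg_one.
Proof. by rewrite /dg_inv /dg_one; case: cid => ops [/= _ _ H] /H[]. Qed.

Lemma dg_mulVl a : gset a -> mul (ginv a) a = dg_one.
Proof. by rewrite /dg_inv /dg_one; case: cid => ops [/= _ _ H] /H[]. Qed.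

Hint Resolve dg_mulS dg_invS dg_oneS : core.

Lemma dg_mulK a b : gset a -> gset b -> mul (ginv a) (mul a b) = b.
Proof. by move=> Ga Gb; rewrite dg_mulA ?dg_mulVl ?dg_mul1; auto. Qed.

Lemma dg_mulKV a b : gset a -> gset b -> mul a (mul (ginv a) b) = b.
Proof. by move=> Ga Gb; rewrite dg_mulA ?dg_mulV ?dg_mul1; auto. Qed.

Lemma dg_mulrK a b : gset a -> gset b -> mul (mul b a) (ginv a) = b.
Proof. by move=> Ga Gb; rewrite -dg_mulA ?dg_mulV ?dg_mulr1; auto. Qed.

Lemma dg_invM a b : gset a -> gset b -> ginv (mul a b) = mul (ginv b) (ginv a).
Proof.
move=> Ga Gb.
have H : mul (mul a b) (mul (ginv b) (ginv a)) = dg_one.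
  by rewrite dg_mulA ?dg_mulrK ?dg_mulV; auto.
by rewrite -[RHS](@dg_mulK (mul a b)) ?H ?dg_mulr1; auto.
Qed.

Lemma dg_invK a : gset a -> ginv (ginv a) = a.
Proof.
move=> Ga; rewrite -[RHS](@dg_mulK (ginv a)) ?dg_mulVl ?dg_mulr1; auto.
Qed.

Lemma dg_inv_unique a b : gset a -> gset b -> mul a b = dg_one -> b = ginv a.
Proof.
by move=> Ga Gb ab1; rewrite -[LHS](dg_mulK Ga Gb) ab1 dg_mulr1; auto.
Qed.

Lemma definable_gset A : definable A gset.
Proof. exact: definable_subset (dg_set_definable G). Qed.

(** [dg_mul] has a definable graph only on [dg_set], which is why membership of both factors is part
    of the set. *)
Lemma definable_mul A (D : set ('I_n -> U)) : definable A D ->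
  definable A [set w : 'I_n + 'I_n -> U | [/\ gset (w \o inl), gset (w \o inr)
    & D (mul (w \o inl) (w \o inr))]].
Proof.
move=> dD.
have dM := definable_subset (@sub0set _ A) (dg_mul_definable G).
have := definable_ex (definable_setI dM (definable_preimage inr dD)).
congr (definable _ _); apply/seteqP; split=> w /=.
  move=> [y [[Ga Gb E] Dy]]; split=> //.
  have -> : mul (w \o inl) (w \o inr) = y by rewrite -[y]/(concat w y \o inr) E.
  exact: Dy.
by move=> [Ga Gb Dw]; exists (mul (w \o inl) (w \o inr)).
Qed.

Lemma definable_rmul A (D : set ('I_n -> U)) b :
  definable A D -> (forall i, A (b i)) -> gset b ->
  definable A (rmul_preimage G D b).
Proof.
move=> dD Ab Gb; have := definable_params Ab (definable_mul dD).
congr (definable _ _); apply/seteqP; split=> a /=; first by case.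
by case=> Ga Dab; split.
Qed.

Lemma definable_lmul A (D : set ('I_n -> U)) b :
  definable A D -> (forall i, A (b i)) -> gset b ->
  definable A [set x | gset x /\ D (mul b x)].
Proof.
move=> dD Ab Gb.
pose swap (x : 'I_n + 'I_n) : 'I_n + 'I_n :=
  match x with inl i => inr i | inr i => inl i end.
have := definable_params Ab (definable_preimage swap (definable_mul dD)).
congr (definable _ _); apply/seteqP; split=> a /=; first by case.
by case=> Ga Dab; split.
Qed.

Lemma automorphism_gset sigma x :
  automorphism sigma -> gset (sigma \o x) <-> gset x.
Proof.
move=> aut; apply: (@definable_automorphism _ _ _ set0) => //.
exact: dg_set_definable.
Qed.

Lemma automorphism_mul sigma a b : automorphism sigma -> gset a -> gset b ->
  sigma \o mul a b = mul (sigma \o a) (sigma \o b).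
Proof.
move=> aut Ga Gb.
have s0 : automorphism_over set0 sigma by [].
have := (definable_automorphism (concat (concat a b) (mul a b)) s0
  (dg_mul_definable G)).2.
by case.
Qed.

Lemma automorphism_dg_inv sigma a : automorphism sigma -> gset a ->
  sigma \o ginv a = ginv (sigma \o a).
Proof.
move=> aut Ga; have Gsa : gset (sigma \o a) by apply/automorphism_gset.
(* The image of the identity is idempotent, hence the identity. *)
have s1 : sigma \o dg_one = dg_one.
  have Gs1 : gset (sigma \o dg_one) by apply/automorphism_gset; auto.
  rewrite -[LHS](dg_mulrK Gs1 Gs1) -automorphism_mul; auto.
  by rewrite dg_mul1 ?dg_mulV; auto.
apply: dg_inv_unique => //; first by apply/automorphism_gset; auto.
by rewrite -automorphism_mul ?dg_mulV; auto.
Qed.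

Lemma rmul_preimage_image sigma (D : set ('I_n -> U)) b :
  automorphism sigma -> gset b ->
  [set sigma \o x | x in rmul_preimage G D b] =
  rmul_preimage G [set sigma \o x | x in D] (sigma \o b).
Proof.
move=> aut Gb; apply/seteqP; split=> [_ [a [Ga Dab] <-]|x [Gx]].
  split; first exact/automorphism_gset.
  by rewrite -automorphism_mul //; exact/comp_image.
have [[tau sK tK] _ _] := aut.
have {1 2}<- : sigma \o (tau \o x) = x by apply/funext => i /=; rewrite tK.
rewrite -automorphism_mul //.
  by move=> /(comp_image _ _ aut) Dx; exists (tau \o x) => //; split=> //;
    apply/(automorphism_gset _ aut); congr gset: Gx;
    apply/funext => i /=; rewrite tK.
by apply/(automorphism_gset _ aut); congr gset: Gx;
    apply/funext => i /=; rewrite tK.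
Qed.

End GroupOperations.

#[global] Hint Resolve dg_mulS dg_invS dg_oneS : core.

(** * The Newelski product *)

Section Newelski.
Variables (L : language) (K : Type) (U : structure L) (n : nat).
Variables (G : definable_group U n) (M : set U).
Hypotheses (U_monster : monster K U) (M_small : small K M).
Local Notation gset := (dg_set G).
Local Notation mul := (dg_mul G).
Local Notation ginv := (dg_inv G).
Implicit Types (p q s : set (set ('I_n -> U))) (D E : set ('I_n -> U)).

(** Brings two sets over one finite tuple, the form of parameters that [newelski] uses; for a single
    set it is applied with [D] = [E]. *)
Lemma definable_range (V : Type) (A : set U) (D E : set (V -> U)) :
  definable A D -> definable A E ->
  exists (m : nat) (d : 'I_m -> U), [/\ forall i, A (d i),
    definable (range d) D & definable (range d) E].
Proof.
move=> dD /(definable_common dD)[m [d [phi [psi [Ad -> ->]]]]].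
by exists m, d; split=> //; [exists m, phi, d | exists m, psi, d];
  split=> // i; exists i.
Qed.

Lemma realizes_gset A q b : SG G q -> realizes A q b -> gset b.
Proof. by move=> [_ qG] bq; apply: bq => //; exact: definable_gset. Qed.

Lemma realizesM q (k : nat) (d : 'I_k -> U) b :
  realizes (M `|` range d) q b -> realizes M q b.
Proof. by apply: realizes_subset; exact: subsetUl. Qed.

Lemma SG_subset q D E : SG G q -> q D -> definable setT E ->
  D `&` gset `<=` E -> q E.
Proof.
move=> [[_ _ qI qS _] qG] qD dE DE; apply: qS DE => //; exact: qI.
Qed.

Lemma SG_nonempty q D : SG G q -> q D -> D !=set0.
Proof.
by move=> [[_ q0 _ _ _] _] qD; apply/set0P/negP => /eqP D0; rewrite D0 in qD.
Qed.

Lemma SG_setC q D : SG G q -> definable setT D -> q (~` D) <-> ~ q D.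
Proof.
move=> [[_ q0 qI _ qC] _] dD; split; last by have [] := qC _ dD.
by move=> qCD /(qI _ _ qCD); rewrite setICl.
Qed.

Lemma rmul_preimageI D E b :
  rmul_preimage G (D `&` E) b = rmul_preimage G D b `&` rmul_preimage G E b.
Proof. by apply/seteqP; split=> a [] => [Ga []|[Ga ?] [_ ?]]; split. Qed.

Lemma rmul_preimageS D E b :
  D `<=` E -> rmul_preimage G D b `<=` rmul_preimage G E b.
Proof. by move=> DE a [Ga /DE]; split. Qed.

Lemma rmul_preimage_set0 b : rmul_preimage G set0 b = set0.
Proof. by apply/seteqP; split=> a // []. Qed.

Lemma rmul_preimage_gset b : gset b -> rmul_preimage G gset b = gset.
Proof. by move=> Gb; apply/seteqP; split=> a; [case | split; auto]. Qed.

Lemma definable_rmulT D b : gset b -> definable setT D ->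
  definable setT (rmul_preimage G D b).
Proof. by move=> Gb dD; exact: definable_rmul. Qed.

Lemma rmul_preimage_complete q D b : SG G q -> gset b -> definable setT D ->
  q (rmul_preimage G D b) \/ q (rmul_preimage G (~` D) b).
Proof.
move=> qS Gb dD; have [qD|qD] := pselect (q (rmul_preimage G D b)).
  by left.
right; move: qD => /(SG_setC qS (definable_rmulT Gb dD)) qD.
apply: (SG_subset qS qD); first exact/definable_rmulT/definable_setC.
by move=> a [nDa Ga]; split=> // Da; apply: nDa.
Qed.

(** The two realizations are conjugate over [M] and [d]; the automorphism preserves [D], and [s] is
    invariant under it. *)
Lemma newelski_indep s q (m : nat) (d : 'I_m -> U) D b b' :
  Defs.invariant M s -> SG G q -> definable (range d) D ->
  realizes (M `|` range d) q b -> realizes (M `|` range d) q b' ->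
  s (rmul_preimage G D b) -> s (rmul_preimage G D b').
Proof.
move=> sM qS dD bq b'q.
have [sigma sMd <-] := realizes_conjugate U_monster qS.1
  (small_params U_monster M_small) bq b'q.
have Gb := realizes_gset qS bq.
have Mo := automorphism_over_subset (@subsetUl _ _ _) sMd.
have Do := automorphism_over_subset (@subsetUr _ _ _) sMd.
move=> /((sM _ Mo _).1); rewrite rmul_preimage_image //; last exact: Do.1.
congr (s (rmul_preimage _ _ _)); apply/seteqP; split=> [_ [x Dx <-]|x Dx].
  exact/(definable_automorphism _ Do).
have [tau [to sK tK]] := automorphism_over_inv Do.
by rewrite (image_compE _ sK tK) /=; exact/(definable_automorphism _ to).
Qed.

Lemma newelskiP s q (m : nat) (d : 'I_m -> U) D b :
  Defs.invariant M s -> SG G q -> definable (range d) D ->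
  realizes (M `|` range d) q b ->
  newelski G M s q D <-> s (rmul_preimage G D b).
Proof.
move=> sM qS dD bq; split=> [|sDb]; last by exists m, d, b.
move=> [m' [d' [b' [dD' b'q sDb']]]].
(* A realization over [M], [d] and [d'] together links the two presentations of [D]. *)
have [b'' b''q] := type_realized U_monster qS.1
  (small_params U_monster (c := d') (small_params U_monster (c := d) M_small)).
apply: (newelski_indep sM qS dD _ bq (b := b'')).
  by apply: realizes_subset b''q; exact: subsetUl.
apply: (newelski_indep sM qS dD' b'q _ sDb').
apply: realizes_subset b''q => u [Mu|du]; last by right.
by left; left.
Qed.

Lemma newelski_SGinv s q :
  SGinv G M s -> SGinv G M q -> SGinv G M (newelski G M s q).
Proof.
move=> [sS sM] [qS qM].
have real m (d : 'I_m -> U) : exists b, realizes (M `|` range d) q b.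
  by apply: (type_realized U_monster qS.1); exact: small_params.
have [s_def s0 sI s_sub sC] := sS.1.
split; first split; first split.
- by move=> D [m [d [b [dD _ _]]]]; exact: definable_setT dD.
- by move=> [m [d [b [_ _]]]]; rewrite rmul_preimage_set0.
- move=> D E sD sE.
  have dT F : newelski G M s q F -> definable setT F.
    by move=> [m [d [b [dF _ _]]]]; exact: definable_setT dF.
  have [m [d [_ dD dE]]] := definable_range (dT _ sD) (dT _ sE).
  have [b bq] := real m d.
  move: sD sE => /(newelskiP sM qS dD bq) sD /(newelskiP sM qS dE bq) sE.
  apply/(newelskiP sM qS (definable_setI dD dE) bq).
  by rewrite rmul_preimageI; exact: sI.
- move=> D E sD dE DE.
  have dD : definable setT D.
    by move: sD => [m [d [b [dF _ _]]]]; exact: definable_setT dF.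
  have [m [d [_ {}dD dEd]]] := definable_range dD dE.
  have [b bq] := real m d; have Gb := realizes_gset qS bq.
  move: sD => /(newelskiP sM qS dD bq) sD.
  apply/(newelskiP sM qS dEd bq).
  by apply: s_sub sD (definable_rmulT Gb dE) _; exact: rmul_preimageS.
- move=> D dD.
  have [m [d [_ dDd _]]] := definable_range dD dD.
  have [b bq] := real m d; have Gb := realizes_gset qS bq.
  have [sD|sD] := rmul_preimage_complete sS Gb dD; [left|right].
    exact/(newelskiP sM qS dDd bq).
  by apply/(newelskiP sM qS (definable_setC dDd) bq).
- have [m [d [_ dG _]]] := definable_range (definable_gset G setT)
    (definable_gset G setT).
  have [b bq] := real m d; have Gb := realizes_gset qS bq.
  apply/(newelskiP sM qS dG bq).
  by rewrite rmul_preimage_gset //; exact: sS.2.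
(* The data (d, b) witnessing [D] are moved to (sigma d, sigma b); invariance of [q] keeps the
   latter a realization over the moved parameters. The converse comes from the inverse
   automorphism. *)
have half sigma D : automorphism_over M sigma ->
    newelski G M s q D -> newelski G M s q [set sigma \o x | x in D].
  move=> so [m [d [b [dD bq sDb]]]].
  exists m, (sigma \o d), (sigma \o b); split.
  - apply: definable_image dD; first exact: so.1.
    by move=> _ [i _ <-]; exists i.
  - apply: (realizes_image so qM _ bq) => u [Mu|[i _ <-]].
      by exists u; [left | exact: so.2].
    by exists (d i) => //; right; exists i.
  - rewrite -rmul_preimage_image; first exact: (sM _ so _).1.
      exact: so.1.
    exact: realizes_gset bq.
move=> sigma so D; split; first exact: half.
have [tau [to sK tK]] := automorphism_over_inv so.
move=> /(half _ _ to); congr newelski.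
rewrite (image_compE _ tK sK); apply/seteqP; split=> x /=.
  by move=> /(comp_image _ _ so.1).
by move=> Dx; apply/(comp_image _ _ so.1).
Qed.

Lemma SG_rtranslate p c : SG G p -> gset c -> SG G (rtranslate G p c).
Proof.
move=> pS Gc; have [p_def p0 pI p_sub pC] := pS.1.
split; first split.
- by move=> D [].
- by move=> [_]; rewrite rmul_preimage_set0.
- move=> D E [dD pD] [dE pE]; split; first exact: definable_setI.
  by rewrite rmul_preimageI; exact: pI.
- move=> D E [dD pD] dE DE; split=> //.
  by apply: p_sub pD (definable_rmulT Gc dE) _; exact: rmul_preimageS.
- move=> D dD; have [pD|pD] := rmul_preimage_complete pS Gc dD; [left|right].
    by split.
  by split=> //; exact: definable_setC.
- split; first exact: definable_gset.
  by rewrite rmul_preimage_gset //; exact: pS.2.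
Qed.

Lemma rtranslate1 p : SG G p -> rtranslate G p (dg_one G) = p.
Proof.
move=> pS; apply/seteqP; split=> D.
  move=> [dD pD]; apply: (SG_subset pS pD) => // a [[Ga]].
  by rewrite dg_mulr1.
move=> pD; have dD : definable setT D by have [+ _ _ _ _] := pS.1; exact.
split=> //; apply: (SG_subset pS pD); first exact: definable_rmulT.
by move=> a [Da Ga]; split; rewrite ?dg_mulr1.
Qed.

Lemma rtranslateM p a b : gset a -> gset b ->
  rtranslate G (rtranslate G p a) b = rtranslate G p (mul a b).
Proof.
move=> Ga Gb.
have E D : rmul_preimage G (rmul_preimage G D b) a =
           rmul_preimage G D (mul a b).
  apply/seteqP; split=> x [Gx]; first by move=> [_]; rewrite -dg_mulA.
  by rewrite dg_mulA //; split=> //; split=> //; exact: dg_mulS.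
apply/seteqP; split=> D [dD]; first by case=> _; rewrite E; split.
by rewrite -E => pD; split=> //; split=> //; exact: definable_rmulT.
Qed.

(** The entries of [c] must lie in [A], so that the preimage of an [A]-definable set under
    translation by [c] is again one that [a] can be tested against. *)
Lemma realizes_rtranslate A p a c :
  (forall i, A (c i)) -> gset c -> SG G p -> realizes A p a ->
  realizes A (rtranslate G p c) (mul a c).
Proof.
move=> Ac Gc pS ap D [_ pD] dD.
by have [] := ap _ pD (definable_rmul dD Ac Gc).
Qed.

End Newelski.

(** * Bounded type-definable subgroups *)

Section BoundedSubgroups.
Variables (L : language) (K : Type) (U : structure L) (n : nat).
Variables (G : definable_group U n).
Hypotheses (U_monster : monster K U).
Local Notation gset := (dg_set G).
Local Notation mul := (dg_mul G).
Local Notation one := (dg_one G).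
Local Notation ginv := (dg_inv G).

Lemma subgroup_closed H : subgroup gset mul H ->
  [/\ H one, forall a b, H a -> H b -> H (mul a b)
    & forall a, H a -> H (ginv a)].
Proof.
move=> [HG [HM HA [e [He e1 eV]]]].
have e_one : e = one.
  have [ee _] := e1 _ He; have Ge := HG _ He.
  by rewrite -[LHS](dg_mulK Ge Ge) ee dg_mulVl.
rewrite e_one in He e1 eV; split=> // a Ha.
have [b [Hb ab _]] := eV _ Ha.
by rewrite -(dg_inv_unique (HG _ Ha) (HG _ Hb) ab).
Qed.

Lemma left_coset_eq H a b : subgroup gset mul H -> gset a -> gset b ->
  left_coset mul H a = left_coset mul H b <-> H (mul (ginv a) b).
Proof.
move=> sH Ga Gb; have [H1 HM HV] := subgroup_closed sH; have HG := sH.1.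
split=> [E|Hab].
  have : left_coset mul H b b by exists one => //; rewrite dg_mulr1.
  by rewrite -E => -[h Hh <-]; rewrite dg_mulK //; exact: HG.
have sub x y : gset x -> gset y -> H (mul (ginv x) y) ->
    left_coset mul H y `<=` left_coset mul H x.
  move=> Gx Gy Hxy _ [h Hh <-]; exists (mul (mul (ginv x) y) h).
    exact: HM.
  have Gh := HG _ Hh.
  by rewrite -(@dg_mulA _ _ _ _ (ginv x)) ?dg_mulKV; auto.
apply/seteqP; split; apply: sub => //.
by have := HV _ Hab; rewrite dg_invM ?dg_invK; auto.
Qed.

Lemma mem_left_coset H a : subgroup gset mul H -> gset a ->
  left_coset mul H a a.
Proof.
move=> /subgroup_closed[H1 _ _] Ga.
by exists one => //; rewrite dg_mulr1.
Qed.

Lemma in_left_coset H a b : subgroup gset mul H -> gset a ->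
  left_coset mul H a b <-> gset b /\ H (mul (ginv a) b).
Proof.
move=> sH Ga; have HG := sH.1; split.
  move=> [h Hh <-]; have Gh := HG _ Hh; split; first by auto.
  by rewrite dg_mulK.
by move=> [Gb Hab]; exists (mul (ginv a) b) => //; rewrite dg_mulKV.
Qed.

(** Otherwise each coset has a definable superset outside [q]. There are few cosets, so the
    parameters of these supersets form a small set; a realization of [q] over it avoids all of them,
    yet lies in its own coset. *)
Lemma concentrates_coset H q :
  bounded_type_definable_subgroup G K H -> SG G q ->
  exists2 g, gset g & concentrates q (left_coset mul H g).
Proof.
move=> [sH _ bH] qS; apply: contrapT => nq.
have [u0] := carrier_inhabited U.
have [par parP] : {par : set ('I_n -> U) -> nat -> U & forall C,
    left_cosets gset mul H C ->
    exists D, [/\ definable (range (par C)) D, C `<=` D & ~ q D]}.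
  apply: (choice (P := fun C par => left_cosets gset mul H C ->
    exists D, [/\ definable (range par) D, C `<=` D & ~ q D])) => C.
  have [[g Gg <-]|nC] := pselect (left_cosets gset mul H C); last first.
    by exists (fun=> u0).
  have : ~ concentrates q (left_coset mul H g).
    by move=> qC; apply: nq; exists g.
  move=> /existsNP[D /not_implyP[dD /not_implyP[CD nqD]]].
  have [m [d [_ dDd _]]] := definable_range dD dD.
  (* Tuples of varying length are padded by [u0] to sequences, so that one choice function covers
     all cosets. *)
  exists (fun k => if insub k is Some i then d i else u0) => _.
  exists D; split=> //; apply: definable_subset dDd => _ [i _ <-].
  by exists (val i) => //; rewrite valK.
pose B := [set par x.1 x.2 | x in left_cosets gset mul H `*` [set: nat]].
have sB : small K B.
  exact: small_le (small_setX U_monster bH (small_nat U_monster))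
    (card_image_le _ _).
have [b bq] := type_realized U_monster qS.1 sB.
have Gb := realizes_gset qS bq.
have Cb : left_cosets gset mul H (left_coset mul H b) by exists b.
have [D [dD CD nqD]] := parP _ Cb.
have {}dD : definable B D.
  by apply: definable_subset dD => _ [k _ <-]; exists (left_coset mul H b, k).
have qCD : q (~` D) by apply/(SG_setC qS (definable_setT dD)).
by apply: (bq _ qCD (definable_setC dD)); apply: CD; exact: mem_left_coset.
Qed.

(** The coset of [g] is cut out by the conditions that g^-1 x lies in [D], for [D] in [F]. Each is
    definable over [A] and g^-1, so [q] contains it and [b] satisfies it. *)
Lemma realizes_coset (A : set U) F q g b :
  F `<=` definable A -> subgroup gset mul (\bigcap_(D in F) D) -> SG G q ->
  gset g -> concentrates q (left_coset mul (\bigcap_(D in F) D) g) ->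
  realizes (A `|` range (ginv g)) q b ->
  left_coset mul (\bigcap_(D in F) D) g b.
Proof.
set H := \bigcap_(D in F) D => FA sH qS Gg qg bq.
have Gb := realizes_gset qS bq.
apply/(in_left_coset _ sH Gg); split=> // D FD.
pose E := [set x | gset x /\ D (mul (ginv g) x)].
have dE : definable (A `|` range (ginv g)) E.
  apply: definable_lmul; last exact: dg_invS.
    exact: definable_subset (@subsetUl _ _ _) (FA _ FD).
  by move=> i; right; exists i.
suff [] : E b by [].
apply: (bq _ _ dE); apply: qg; first exact: definable_setT dE.
by move=> x /(in_left_coset _ sH Gg)[Gx Hx]; split=> //; exact: Hx.
Qed.

End BoundedSubgroups.

(** * The stabilizer of a strong right f-generic type *)

Section Stabilizer.
Variables (L : language) (K : Type) (U : structure L) (n : nat).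
Variables (G : definable_group U n) (M : set U).
Variable p : set (set ('I_n -> U)).
Hypotheses (U_monster : monster K U) (M_small : small K M).
Hypotheses (p_inv : SGinv G M p) (p_generic : strong_right_fgeneric G M p).
Local Notation gset := (dg_set G).
Local Notation mul := (dg_mul G).
Local Notation one := (dg_one G).
Local Notation ginv := (dg_inv G).
Local Notation "p .* c" := (rtranslate G p c) (at level 40).

Let pS : SG G p := p_inv.1.
Let pM : Defs.invariant M p := p_inv.2.

Definition stabilizer := [set h | gset h /\ p .* h = p].

Lemma rtranslate_SGinv c : gset c -> SGinv G M (p .* c).
Proof. by move=> Gc; split; [exact: SG_rtranslate | exact: p_generic]. Qed.

Lemma rtranslate_generic c : gset c -> strong_right_fgeneric G M (p .* c).
Proof. by move=> Gc d Gd; rewrite rtranslateM //; apply: p_generic; auto. Qed.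

(** Moving [p . c] by sigma gives sigma(p) . sigma(c) = p . sigma(c), as [p] is invariant; it also
    gives back [p . c], by strong genericity. *)
Lemma rtranslate_automorphism sigma c : automorphism_over M sigma -> gset c ->
  p .* (sigma \o c) = p .* c.
Proof.
have half rho d : automorphism_over M rho -> gset d ->
    p .* d `<=` p .* (rho \o d).
  move=> ro Gd D [dD pD]; split=> //.
  have [tau [to sK tK]] := automorphism_over_inv ro.
  have [_ /(pM ro _).1] := (p_generic Gd to D).1 (conj dD pD).
  rewrite rmul_preimage_image //; last exact: ro.1.
  congr (p (rmul_preimage _ _ _)); rewrite (image_compE D tK sK).
  apply/seteqP; split=> [_ [x Dx <-] //|x Dx].
  exists (tau \o x); last by apply/funext => i /=; rewrite tK.
  by congr D: Dx; apply/funext => i /=; rewrite tK.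
move=> so Gc; apply/seteqP; split; last exact: half.
have [tau [to sK tK]] := automorphism_over_inv so.
have Gsc : gset (sigma \o c) by apply/automorphism_gset => //; exact: so.1.
have /(half _ _ to) := Gsc; congr (_ `<=` rtranslate G p _).
by apply/funext => i /=; rewrite sK.
Qed.

Lemma rtranslate_realizes q b b' : SG G q -> realizes M q b ->
  realizes M q b' -> p .* b = p .* b'.
Proof.
move=> qS bq b'q.
have [sigma so <-] := realizes_conjugate U_monster qS.1 M_small bq b'q.
by rewrite rtranslate_automorphism //; exact: realizes_gset bq.
Qed.

(** The product asks for a realization [b] of [q] over [M] and [d], but [p . b] only depends on the
    type over [M], so one [c] works for all [d]. As [q] is any type in [SG G], this also governs p *
    S_G(U). *)
Lemma newelski_rtranslate q c : SG G q -> realizes M q c ->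
  newelski G M p q = p .* c.
Proof.
move=> qS cq; have Gc := realizes_gset qS cq.
apply/seteqP; split=> D.
  move=> [m [d [b [dD bq pD]]]].
  rewrite (rtranslate_realizes qS cq (realizesM bq)).
  by split=> //; exact: definable_setT dD.
move=> pcD; have [dD _] := pcD.
have [m [d [_ {}dD _]]] := definable_range dD dD.
have [b bq] := type_realized U_monster qS.1
  (small_params U_monster (c := d) M_small).
move: pcD; rewrite (rtranslate_realizes qS cq (realizesM bq)) => -[_ pD].
by exists m, d, b.
Qed.

Lemma rtranslate_mulV a : gset a -> p .* a .* ginv a = p.
Proof. by move=> Ga; rewrite rtranslateM ?dg_mulV ?rtranslate1; auto. Qed.

Lemma rtranslate_mulVl a : gset a -> p .* ginv a .* a = p.
Proof. by move=> Ga; rewrite rtranslateM ?dg_mulVl ?rtranslate1; auto. Qed.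

Lemma stabilizer_subgroup : subgroup gset mul stabilizer.
Proof.
have S1 : stabilizer one by split; [auto | exact: rtranslate1].
split; first by move=> h [].
split.
- move=> a b [Ga pa] [Gb pb]; split; first by auto.
  by rewrite -rtranslateM // pa.
- by move=> a b c [Ga _] [Gb _] [Gc _]; exact: dg_mulA.
exists one; split=> //.
  by move=> a [Ga _]; rewrite dg_mul1 ?dg_mulr1.
move=> a [Ga pa]; exists (ginv a); rewrite dg_mulV ?dg_mulVl //; split=> //.
by split; [auto | rewrite -{1}pa rtranslate_mulV].
Qed.

(** As sigma(a)^-1 is the conjugate of a^-1, both translate [p] to the same type; translating that
    type by sigma(a) leads back to [p]. *)
Lemma stabilizer_conjugate sigma a : automorphism_over M sigma -> gset a ->
  stabilizer (mul (ginv a) (sigma \o a)).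
Proof.
move=> so Ga; have Gsa : gset (sigma \o a).
  by apply/automorphism_gset => //; exact: so.1.
split; first by auto.
rewrite -rtranslateM; auto.
have := rtranslate_automorphism so (dg_invS Ga).
rewrite automorphism_dg_inv //; last exact: so.1.
by move=> <-; exact: rtranslate_mulVl.
Qed.

Lemma stabilizer_realizes q a b : SG G q -> realizes M q a -> realizes M q b ->
  stabilizer (mul (ginv a) b).
Proof.
move=> qS aq bq.
have [sigma so <-] := realizes_conjugate U_monster qS.1 M_small aq bq.
by apply: stabilizer_conjugate => //; exact: realizes_gset aq.
Qed.

(* For [a] realizing [p] over [M], [g] and [h], the elements [a g] and [a h g]
   both realize [p . g] over [M]. *)
Lemma stabilizer_normal g h : gset g -> stabilizer h ->
  stabilizer (mul (ginv g) (mul h g)).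
Proof.
move=> Gg [Gh ph].
have [a ap] := type_realized U_monster pS.1
  (small_params U_monster (c := mul h g) (small_params U_monster (c := g) M_small)).
have Ga := realizes_gset pS ap.
have E : p .* mul h g = p .* g by rewrite -rtranslateM // ph.
have ag : realizes M (p .* g) (mul a g).
  apply: realizes_subset (realizes_rtranslate _ Gg pS ap).
    by move=> u; left; left.
  by move=> i; left; right; exists i.
have ahg : realizes M (p .* g) (mul a (mul h g)).
  rewrite -E; apply: realizes_subset (realizes_rtranslate _ _ pS ap); auto.
    by move=> u; left; left.
  by move=> i; right; exists i.
have := stabilizer_realizes (SG_rtranslate pS Gg) ag ahg.
by rewrite dg_invM // -dg_mulA ?dg_mulK; auto.
Qed.

(** Equality of the translates gives b a^-1 in the stabilizer at once; conjugating by [a] yields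
    a^-1 b, and the converse conjugates back. *)
Lemma rtranslate_eq a b : gset a -> gset b ->
  p .* a = p .* b <-> stabilizer (mul (ginv a) b).
Proof.
move=> Ga Gb; split=> [E|Sab].
  have /(stabilizer_normal Ga) : stabilizer (mul b (ginv a)).
    by split; [auto | rewrite -rtranslateM -?E ?rtranslate_mulV; auto].
  by rewrite -dg_mulA ?dg_mulVl ?dg_mulr1; auto.
have /stabilizer_normal/(_ Sab) [_] : gset (ginv a) by auto.
rewrite dg_invK // -(@dg_mulA _ _ _ _ (ginv a)) ?dg_mulKV; auto => E.
rewrite -{1}E rtranslateM; auto.
by rewrite -dg_mulA ?dg_mulVl ?dg_mulr1; auto.
Qed.

Lemma stabilizer_type_definable : type_definable K stabilizer.
Proof.
(* The approximation by [D] to the condition that some [a] and [a h] both realize [p] over [M]. The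
   sets in [p] being closed under intersection, saturation over [M] and [h] finds one [a] for all
   [D]. *)
pose X D := [set h | gset h /\ exists a, [/\ gset a, D a & D (mul a h)]].
exists M, [set X D | D in p `&` definable M]; split=> //.
  move=> _ [D [pD dD] <-].
  pose swap (x : 'I_n + 'I_n) : 'I_n + 'I_n :=
    match x with inl i => inr i | inr i => inl i end.
  have := definable_ex (definable_preimage swap (definable_setI
    (definable_preimage inl dD) (definable_mul G dD))).
  congr (definable _ _); apply/seteqP; split=> h /=.
    by move=> [a [Da [Ga Gh Dah]]]; split=> //; exists a.
  by move=> [Gh [a [Ga Da Dah]]]; exists a.
have [_ _ pI _ _] := pS.1.
apply/seteqP; split=> h.
  move=> [Gh ph] _ [D [pD dD] <-]; split=> //.
  have pDh : p (rmul_preimage G D h) by move: pD; rewrite -{1}ph => -[].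
  have [a [Da [Ga Dah]]] := SG_nonempty pS (pI _ _ pD pDh).
  by exists a.
move=> hX.
have pG : (p `&` definable M) gset.
  by split; [exact: pS.2 | exact: definable_gset].
have [|Gh _] := hX (X gset); first by exists gset.
have [|_ [D pD <-]|_ [D pD <-]|_ _ [D [pD dD] <-] [E [pE dE] <-]|a aP] :=
    saturation U_monster (small_params U_monster (c := h) M_small)
    (F := [set D `&` rmul_preimage G D h | D in p `&` definable M]).
- by exists (gset `&` rmul_preimage G gset h); exists gset.
- have dD := definable_subset (@subsetUl _ M (range h)) pD.2.
  apply: definable_setI => //; apply: definable_rmul => //.
  by move=> i; right; exists i.
- have [|_ [a [Ga Da Dah]]] := hX (X D); first by exists D.
  by exists a.
- exists ((D `&` E) `&` rmul_preimage G (D `&` E) h).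
    by exists (D `&` E) => //; split; [exact: pI | exact: definable_setI].
  by move=> x [[Dx Ex] [Gx [Dxh Exh]]].
have aP' D : p D -> definable M D -> D a /\ D (mul a h).
  move=> pD dD; have [|Da [_ Dah]] := aP (D `&` rmul_preimage G D h) => //.
  by exists D.
have ap : realizes M p a by move=> D pD /(aP' _ pD)[].
have ahp : realizes M p (mul a h) by move=> D pD /(aP' _ pD)[].
have := stabilizer_realizes pS ap ahp; rewrite dg_mulK //.
exact: realizes_gset ap.
Qed.

Lemma stabilizer_small_index : small K (left_cosets gset mul stabilizer).
Proof.
have sM := small_power U_monster (small_definable (n := n) U_monster M_small).
apply: small_le sM _.
(* A coset is related to the types over [M] of its elements. Elements of the same type are conjugate
   over [M], hence in one coset by [stabilizer_conjugate]. *)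
apply/card_le_relP; exists (fun C q => exists c, [/\ gset c,
  C = left_coset mul stabilizer c & q = [set D | definable M D /\ D c]]); split.
  move=> _ [c Gc <-]; exists [set D | definable M D /\ D c].
    by move=> D [].
  by exists c.
move=> C C' q _ _ [c [Gc -> ->]] [c' [Gc' -> E]].
apply/left_coset_eq => //; first exact: stabilizer_subgroup.
have [D dD Dc|sigma so <-] :=
    type_homogeneous U_monster (b := c) (b' := c') M_small.
  have : [set D | definable M D /\ D c] D by [].
  by rewrite E => -[].
exact: stabilizer_conjugate.
Qed.

Lemma stabilizer_bounded : bounded_type_definable_subgroup G K stabilizer.
Proof.
split; first exact: stabilizer_subgroup.
  exact: stabilizer_type_definable.
exact: stabilizer_small_index.
Qed.

(* [p] concentrates on a coset [g H]; if [h] stabilizes [p] and [b] realizes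
   [p] over enough parameters, then [b] and [b h] both lie in [g H]. *)
Lemma stabilizer_subset H :
  bounded_type_definable_subgroup G K H -> stabilizer `<=` H.
Proof.
move=> bH h [Gh ph]; have [g Gg pg] := concentrates_coset U_monster bH pS.
have [sH [A [F [sA FA HF]]] _] := bH; subst H.
have [b bp] := type_realized U_monster pS.1 (small_params U_monster (c := h)
  (small_params U_monster (c := ginv g) sA)).
have Gb := realizes_gset pS bp.
have bg := realizes_coset FA sH pS Gg pg (realizes_subset (@subsetUl _ _ _) bp).
have bhp : realizes (A `|` range (ginv g)) p (mul b h).
  rewrite -ph; apply: realizes_subset (realizes_rtranslate _ Gh pS bp).
    exact: subsetUl.
  by move=> i; right; exists i.
have bhg := realizes_coset FA sH pS Gg pg bhp.
move: bg bhg => /(in_left_coset _ sH Gg)[_ Hb] /(in_left_coset _ sH Gg)[_ Hbh].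
have [_ HM HV] := subgroup_closed sH.
have := HM _ _ (HV _ Hb) Hbh.
rewrite dg_invM ?dg_invK; auto.
by rewrite -(@dg_mulA _ _ _ _ (ginv b)) ?dg_mulKV ?dg_mulK; auto.
Qed.

Lemma G00_stabilizer : G00 G K = stabilizer.
Proof.
apply/seteqP; split=> h; first by apply; exact: stabilizer_bounded.
by move=> Sh H /stabilizer_subset; exact.
Qed.

End Stabilizer.

(** * The Ellis subgroup of a strong right f-generic type *)

(** Pulls the group axioms back along a bijective homomorphism; the translates of [p] receive
    associativity, identity and inverses from the quotient in this way. *)
Lemma is_group_bij (X Y : Type) (A : set X) (opA : X -> X -> X) (B : set Y)
    (opB : Y -> Y -> Y) (f : X -> Y) :
  (forall x y, A x -> A y -> A (opA x y)) -> is_group B opB ->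
  set_bij A B f ->
  (forall x y, A x -> A y -> f (opA x y) = opB (f x) (f y)) -> is_group A opA.
Proof.
move=> AM [BM BA [e [Be e1 eV]]] [fS finj fsurj] fM.
have {}finj x y : A x -> A y -> f x = f y -> x = y.
  by move=> Ax Ay; apply: finj; exact: mem_set.
split=> //.
  move=> x y z Ax Ay Az; have [Axy Ayz] := (AM _ _ Ax Ay, AM _ _ Ay Az).
  by apply: finj; rewrite ?fM //; [exact: AM | exact: AM | apply: BA; exact: fS].
have [a Aa fa] := fsurj _ Be.
exists a; split=> // x Ax; have Bx := fS _ Ax.
  by split; apply: finj => //; try exact: AM; rewrite fM // fa; case: (e1 _ Bx).
have [y By [xy yx]] : exists2 y, B y & opB (f x) y = e /\ opB y (f x) = e.
  by have [y [By xy yx]] := eV _ Bx; exists y.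
have [z Az fz] := fsurj _ By.
by exists z; split=> //; apply: finj => //; try exact: AM; rewrite fM // fz fa.
Qed.

Section Ellis.
Variables (L : language) (K : Type) (U : structure L) (n : nat).
Variables (G : definable_group U n) (M : set U).
Variable p : set (set ('I_n -> U)).
Hypotheses (U_monster : monster K U) (M_small : small K M).
Hypotheses (p_inv : SGinv G M p) (p_generic : strong_right_fgeneric G M p).
Local Notation gset := (dg_set G).
Local Notation mul := (dg_mul G).
Local Notation one := (dg_one G).
Local Notation ginv := (dg_inv G).
Local Notation "p .* c" := (rtranslate G p c) (at level 40).
Local Notation op := (newelski G M).
Local Notation G0 := (G00 G K).
Local Notation pG := [set p .* c | c in gset].

Let pS : SG G p := p_inv.1.

Let G0_subgroup : subgroup gset mul G0.
Proof.
rewrite (G00_stabilizer U_monster M_small p_inv p_generic).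
exact: stabilizer_subgroup p_inv.
Qed.

Lemma G00_normal g h : gset g -> G0 h -> G0 (mul (ginv g) (mul h g)).
Proof.
rewrite (G00_stabilizer U_monster M_small p_inv p_generic).
by move=> Gg; apply: (stabilizer_normal U_monster M_small p_inv p_generic Gg).
Qed.

Lemma rtranslate_cosetP a b : gset a -> gset b ->
  p .* a = p .* b <-> left_coset mul G0 a = left_coset mul G0 b.
Proof.
move=> Ga Gb; apply: iff_trans (iff_sym (left_coset_eq G0_subgroup Ga Gb)).
rewrite (G00_stabilizer U_monster M_small p_inv p_generic).
exact: (rtranslate_eq U_monster M_small p_inv p_generic Ga Gb).
Qed.

Lemma setop_left_coset a b : gset a -> gset b ->
  setop mul (left_coset mul G0 a) (left_coset mul G0 b) =
  left_coset mul G0 (mul a b).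
Proof.
move=> Ga Gb; have [H1 HM HV] := subgroup_closed G0_subgroup.
have HG := G0_subgroup.1.
apply/seteqP; split=> [_ [_ [_ [[h Hh <-] [k Hk <-] ->]]]|_ [h Hh <-]].
  have Gh := HG _ Hh; have Gk := HG _ Hk.
  (* Normality moves [h] past [b]: a h b k = a b (b^-1 h b) k. *)
  exists (mul (mul (ginv b) (mul h b)) k).
    by apply: HM => //; exact: G00_normal.
  rewrite -!dg_mulA ?dg_mulKV; auto 6.
have Gh := HG _ Hh; exists a, (mul b h); rewrite dg_mulA //; split=> //.
  by exists one => //; rewrite dg_mulr1.
by exists h.
Qed.

Lemma quotient00_group : is_group (quotient00 G K) (setop mul).
Proof.
split.
- move=> _ _ [a Ga <-] [b Gb <-]; rewrite setop_left_coset //.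
  by exists (mul a b) => //; auto.
- move=> _ _ _ [a Ga <-] [b Gb <-] [c Gc <-].
  by rewrite !setop_left_coset ?dg_mulA; auto.
exists (left_coset mul G0 one); split; first by exists one; auto.
  by move=> _ [a Ga <-]; rewrite !setop_left_coset ?dg_mul1 ?dg_mulr1; auto.
move=> _ [a Ga <-]; exists (left_coset mul G0 (ginv a)).
rewrite !setop_left_coset ?dg_mulV ?dg_mulVl; auto; split=> //.
by exists (ginv a) => //; auto.
Qed.

Lemma pihat_rtranslate a c : realizes M p a -> gset c ->
  pihat G K (p .* c) = left_coset mul G0 (mul a c).
Proof.
move=> ap Gc; have Ga := realizes_gset pS ap.
have bS : bounded_type_definable_subgroup G K G0.
  rewrite (G00_stabilizer U_monster M_small p_inv p_generic).
  exact: stabilizer_bounded U_monster M_small p_inv p_generic.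
have pcS := SG_rtranslate pS Gc.
have [_ [A [F [sA FA HF]]] _] := bS.
have sH : subgroup gset mul (\bigcap_(D in F) D) by rewrite -HF.
(* With [b] realizing [p] over enough parameters, [b c] lies in any coset on which [p . c]
   concentrates. As [a] and [b] both realize [p] over [M], the elements [a c] and [b c] lie in the
   same coset. *)
have uniq g : gset g -> concentrates (p .* c) (left_coset mul G0 g) ->
    left_coset mul G0 g = left_coset mul G0 (mul a c).
  move=> Gg; rewrite HF => pg.
  have [b bp] := type_realized U_monster pS.1 (small_params U_monster (c := c)
    (small_params U_monster (c := ginv g) (small_setU U_monster sA M_small))).
  have Gb := realizes_gset pS bp.
  have bg : left_coset mul (\bigcap_(D in F) D) g (mul b c).
    apply: (realizes_coset FA sH pcS Gg pg).
    apply: realizes_subset (realizes_rtranslate _ Gc pS bp).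
      by move=> u [Au|gu]; left; [left; left | right].
    by move=> i; right; exists i.
  have /(in_left_coset _ sH Gg)[_] := bg.
  rewrite -HF => /(left_coset_eq G0_subgroup Gg _).2 -> //; last by auto.
  apply/rtranslate_cosetP; auto.
  rewrite -!rtranslateM //; congr rtranslate.
  apply: (rtranslate_realizes U_monster M_small p_inv p_generic pS) => //.
  by apply: realizes_subset bp => u Mu; left; left; right.
have [g Gg pg] := concentrates_coset U_monster bS pcS.
apply: xget_unique.
  by rewrite -(uniq g) //; split=> //; exists g.
by move=> _ [[g' Gg' <-]]; exact: uniq.
Qed.

Lemma rtranslate_op a b c : realizes M p a -> gset b -> gset c ->
  op (p .* b) (p .* c) = p .* (mul b (mul a c)).
Proof.
move=> ap Gb Gc; have Ga := realizes_gset pS ap.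
(* [a] realizes [p] over [M] only, and [c] need not lie in [M]; so a realization over [M] and [c] is
   used first, and exchanged for [a] at the level of cosets. *)
have [a' a'p] := type_realized U_monster pS.1
  (small_params U_monster (c := c) M_small).
have Ga' := realizes_gset pS a'p.
have a'c : realizes M (p .* c) (mul a' c).
  apply: realizes_subset (realizes_rtranslate _ Gc pS a'p) => [u|i]; first by left.
  by right; exists i.
rewrite (newelski_rtranslate U_monster M_small
  (rtranslate_SGinv p_inv p_generic Gb) (rtranslate_generic p_generic Gb)
  (SG_rtranslate pS Gc) a'c).
rewrite rtranslateM; auto.
apply/rtranslate_cosetP; auto.
have aa' : left_coset mul G0 a' = left_coset mul G0 a.
  apply/rtranslate_cosetP => //.
  exact: (rtranslate_realizes U_monster M_small p_inv p_generic pS (realizesM a'p)).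
by rewrite -!setop_left_coset ?aa'; auto.
Qed.

Lemma newelski_in_rtranslates q : SG G q -> pG (op p q).
Proof.
move=> qS; have [c cq] := type_realized U_monster qS.1 M_small.
exists c; first exact: realizes_gset cq.
by rewrite (newelski_rtranslate U_monster M_small p_inv p_generic qS cq).
Qed.

Lemma newelski_SGinv_rtranslates : [set op p q | q in SGinv G M] = pG.
Proof.
apply/seteqP; split=> [_ [q [qS _] <-]|_ [c Gc <-]].
  exact: newelski_in_rtranslates.
have [a ap] := type_realized U_monster pS.1 M_small.
have Ga := realizes_gset pS ap.
(* The factor a^-1 cancels the [a] that the product inserts: p * (p . a^-1 c) = p . c. *)
exists (p .* mul (ginv a) c); first by apply: rtranslate_SGinv; auto.
rewrite -{1}(rtranslate1 pS) (rtranslate_op ap); auto.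
by rewrite dg_mulKV ?dg_mul1.
Qed.

Lemma newelski_SG_rtranslates : pG = [set op p q | q in SG G].
Proof.
apply/seteqP; split=> [|_ [q qS <-]]; last exact: newelski_in_rtranslates.
by rewrite -newelski_SGinv_rtranslates => _ [q [qS _] <-]; exists q.
Qed.

Lemma pihat_isomorphism :
  group_isomorphism pG op (quotient00 G K) (setop mul) (pihat G K).
Proof.
have [a ap] := type_realized U_monster pS.1 M_small.
have Ga := realizes_gset pS ap.
have f_bij : set_bij pG (quotient00 G K) (pihat G K).
  split.
  - move=> _ [c Gc <-]; rewrite (pihat_rtranslate ap) //.
    by exists (mul a c); auto.
  - move=> x y /set_mem[b Gb <-] /set_mem[c Gc <-].
    rewrite !(pihat_rtranslate ap) // => E.
    apply/rtranslate_cosetP => //; move: E.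
    move=> /left_coset_eq => /(_ G0_subgroup (dg_mulS Ga Gb) (dg_mulS Ga Gc)).
    rewrite dg_invM // -dg_mulA ?dg_mulK; auto.
    by move=> ?; apply/left_coset_eq.
  - move=> _ [c Gc <-]; exists (p .* mul (ginv a) c).
      by exists (mul (ginv a) c); auto.
    by rewrite (pihat_rtranslate ap) ?dg_mulKV; auto.
have fM x y : pG x -> pG y ->
    pihat G K (op x y) = setop mul (pihat G K x) (pihat G K y).
  move=> [b Gb <-] [c Gc <-].
  rewrite (rtranslate_op ap) // !(pihat_rtranslate ap) ?setop_left_coset; auto.
  by rewrite dg_mulA; auto.
split=> //; last exact: quotient00_group.
apply: (is_group_bij _ quotient00_group f_bij fM) => _ _ [b Gb <-] [c Gc <-].
by rewrite (rtranslate_op ap) //; exists (mul b (mul a c)); auto.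
Qed.

(** The minimal left ideal [I] is the one generated by [p], and the idempotent is p . a^-1, which is
    a left identity on the translates. *)
Lemma rtranslates_ellis_subgroup : ellis_subgroup (SGinv G M) op pG.
Proof.
split; first by have [] := pihat_isomorphism.
have [a ap] := type_realized U_monster pS.1 M_small.
have Ga := realizes_gset pS ap.
have GV := dg_invS Ga.
(* Unlike [S * p], this is a left ideal without appeal to associativity. *)
pose I := [set x | forall J, left_ideal (SGinv G M) op J -> J p -> J x].
have S_ideal : left_ideal (SGinv G M) op (SGinv G M).
  by split=> //; [exists p | move=> s x Ss Sx; exact: (newelski_SGinv U_monster)].
have IS : I `<=` SGinv G M by move=> x /(_ _ S_ideal); exact.
have P_inv c : gset c -> SGinv G M (p .* c) by move=> Gc; exact: rtranslate_SGinv.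
have p_op b : gset b -> op (p .* b) p = p .* mul b a.
  by move=> Gb; rewrite -{2}(rtranslate1 pS) (rtranslate_op ap) ?dg_mulr1; auto.
have P_ideal J c : left_ideal (SGinv G M) op J -> J p -> gset c -> J (p .* c).
  move=> [_ _ JM] Jp Gc.
  (* Left multiples of [p] already exhaust its translates, so a left ideal containing [p] contains
     them all. *)
  have -> : p .* c = op (p .* mul c (ginv a)) p.
    by rewrite p_op -?dg_mulA ?dg_mulVl ?dg_mulr1; auto.
  by apply: JM => //; apply: P_inv; auto.
exists I, (p .* ginv a); split.
- split.
    split=> //; first by exists p => J.
    by move=> s x Ss Ix J iJ Jp; have [_ _ JM] := iJ; apply: JM => //; exact: Ix.
  move=> J iJ JI; apply/seteqP; split=> // x; apply => //.
  have [JS [y Jy] JM] := iJ.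
  have [c Gc pc] := newelski_in_rtranslates (JS _ Jy).1.
  (* A left ideal inside [I] contains some p * y = p . c, and multiplying by p . (c^-1 a^-1) on the
     left recovers [p]; so it contains [I]. *)
  have Jpc : J (p .* c) by rewrite pc; exact: JM.
  have -> : p = op (p .* mul (ginv c) (ginv a)) (p .* c).
    rewrite (rtranslate_op ap) -?dg_mulA ?dg_mulK ?dg_mulVl; auto.
    by rewrite rtranslate1.
  by apply: JM => //; apply: P_inv; auto.
- by move=> J iJ Jp; exact: P_ideal.
- by rewrite (rtranslate_op ap) // dg_mulK.
apply/seteqP; split=> [_ [c Gc <-]|_ [x Ix <-]].
  exists (p .* c); first by move=> J iJ Jp; exact: P_ideal.
  by rewrite (rtranslate_op ap) // dg_mulK.
(* For arbitrary [x], the idempotent is itself strong right f-generic, so its product with [x] is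
   its translate by a realization of [x] over [M]. *)
have [xS _] := IS _ Ix; have [c cx] := type_realized U_monster xS.1 M_small.
have Gc := realizes_gset xS cx.
rewrite (newelski_rtranslate U_monster M_small (P_inv _ GV)
  (rtranslate_generic p_generic GV) xS cx) rtranslateM //.
by exists (mul (ginv a) c); auto.
Qed.

Lemma rtranslates_representatives B : coset_representatives G K B ->
  pG = [set p .* b | b in B].
Proof.
move=> [BG Brep]; apply/seteqP.
split=> [_ [c Gc <-]|_ [b /BG Gb <-]]; last by exists b.
have [|b [[Bb cb] _]] := Brep (left_coset mul G0 c); first by exists c.
exists b => //; apply/rtranslate_cosetP; auto.
move: cb => /(in_left_coset _ G0_subgroup Gc)[Gb Hcb].
by apply/esym/left_coset_eq.
Qed.

End Ellis.

Theorem theorem3p5 (R : realType) (L : language) (T : theory L)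
    (K : Type) (U : structure L) (M : set U) (n : nat)
    (G : definable_group U n) (p : set (set ('I_n -> U)))
    (T_NIP : NIP T) (U_T : models U T) (U_monster : monster K U)
    (M_elementary : elementary_submodel M) (M_small : small K M)
    (G_amenable : definably_amenable G R)
    (p_inv : SGinv G M p) (p_generic : strong_right_fgeneric G M p) :
  let S := SGinv G M in
  let op := newelski G M in
  let pS := [set op p q | q in S] in
  let pG := [set rtranslate G p c | c in dg_set G] in
  let quotient_mul := setop (dg_mul G) in
  [/\ ellis_subgroup S op pS,
      pS = pG /\ pG = [set op p q | q in SG G],
      forall B, coset_representatives G K B ->
        let pB := [set rtranslate G p b | b in B] in
        pG = pB /\
        group_isomorphism pB op (quotient00 G K) quotient_mul (pihat G K)
    & group_isomorphism pS op (quotient00 G K) quotient_mul (pihat G K)].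
Proof.
have pSE := newelski_SGinv_rtranslates U_monster M_small p_inv p_generic.
have pG_iso := pihat_isomorphism U_monster M_small p_inv p_generic.
move=> S op pS pG quotient_mul; rewrite /pS /S /op pSE; split=> //.
- exact: rtranslates_ellis_subgroup U_monster M_small p_inv p_generic.
- split=> //.
  exact: newelski_SG_rtranslates U_monster M_small p_inv p_generic.
- move=> B repB.
  have pGB :=
    rtranslates_representatives U_monster M_small p_inv p_generic repB.
  by rewrite -pGB.
Qed.
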